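(* Let $\alpha>1$ and let $(Y_k)_{k\in\mathbb{N}}$ be a sequence of independent, nonnegative random variables with finite means. Suppose there is a random variable $Y_\infty$ with finite mean such that, as $k\to\infty$, $\alpha^{-k}Y_k \to Y_\infty$ in distribution and $\alpha^{-k}EY_k\to EY_\infty$, and suppose that $P(Y_\infty=y)=0$ for all $y\in\mathbb{R}_+$. Let $N_t$ be the number of renewals up to and including time $t$ associated with $(Y_k)_{k\in\mathbb{N}}$, let $S_\infty=\sum_{k=0}^\infty \alpha^{-k}Y_{\infty,k}$ where $(Y_{\infty,k})_{k\in\mathbb{N}_0}$ are independent random variables all with the distribution of $Y_\infty$, and let $Q_\eta$ be the distribution of $\lfloor -\log_\alpha S_\infty+\eta\rfloor$ for $0\le \eta\le 1$. If $(t_n)_{n\in\mathbb{N}}$ is a sequence of real numbers with $t_n\to\infty$ and such that $\{\log_\alpha t_n\}\to\eta$ for some $\eta\in[0,1]$, then $$N_{t_n}-\lfloor \log_\alpha t_n\rfloor \to Q_\eta \quad\text{in distribution as } n\to\infty.$$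
   Context: $\mathbb{N}=\{1,2,\dots\}$, $\mathbb{N}_0=\{0,1,2,\dots\}$, $\mathbb{R}_+=[0,\infty)$. Set $S_0:=0$, $S_n:=\sum_{k=1}^n Y_k$ for $n\in\mathbb{N}$, and $N_t:=\sup\{n\in\mathbb{N}_0: S_n\le t\}$ for $t\ge 0$. For real $x$, $\lfloor x\rfloor$ is the greatest integer less than or equal to $x$ and $\{x\}=x-\lfloor x\rfloor$ is its fractional part. $\log_\alpha$ is the logarithm to base $\alpha$ (since $t_n\to\infty$, $\log_\alpha t_n$ is defined for all large $n$). Convergence in distribution of random variables to a probability measure $\mu$ means weak convergence of their laws to $\mu$. Under the hypotheses $0<S_\infty<\infty$ almost surely, so that $\log_\alpha S_\infty$ is well defined almost surely. *)

(* Defs.v *)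
From HB Require Import structures.
From mathcomp Require Import all_boot all_order all_algebra finmap.
From mathcomp Require Import all_classical all_reals all_analysis.
From mathcomp Require Import measurable_realfun.

Set Implicit Arguments.
Unset Strict Implicit.
Unset Printing Implicit Defensive.

Import Order.TTheory GRing.Theory Num.Theory.
Import numFieldNormedType.Exports.

Local Open Scope classical_set_scope.
Local Open Scope ring_scope.

Definition log_base {R : realType} (a x : R) : R := ln x / ln a.

Definition frac_part {R : realType} (x : R) : R := x - (Num.floor x)%:~R.

Definition mutually_independent {d} {T : measurableType d} {R : realType}
    (P : probability T R) {I : choiceType} (D : set I)
    (X : I -> {RV P >-> R}) : Prop :=
  forall (J : {fset I}) (B : I -> set R),
    [set` J] `<=` D ->
    (forall i, i \in J -> measurable (B i)) ->
    P (\bigcap_(i in [set` J]) (X i @^-1` B i)) =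
    (\prod_(i <- J) P (X i @^-1` B i))%E.
Arguments mutually_independent {d T R} P {I} D X.

Definition weak_cvg {R : realType}
    (mu_ : nat -> probability R R) (mu : probability R R) : Prop :=
  forall f : R -> R, continuous f -> bounded_fun f ->
    (\int[mu_ n]_x (f x)%:E)%E @[n --> \oo] --> (\int[mu]_x (f x)%:E)%E.

Section renewal.
Context {d} {T : measurableType d} {R : realType}.

(* Summands are numbered from 1; [Y 0] is not used. *)
Definition partial_sum (Y : nat -> T -> R) (n : nat) (w : T) : R :=
  \sum_(1 <= k < n.+1) Y k w.

Definition renewal_sup (Y : nat -> T -> R) (t : R) (w : T) : \bar R :=
  ereal_sup [set n%:R%:E | n in [set n : nat | partial_sum Y n w <= t]].

(* N_t as a real number: [fine] gives 0 where the supremum is infinite, i.e.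
   when no n satisfies S_n <= t (possible only for t < 0) or infinitely many
   n do (a null event as soon as S_n tends to +oo almost surely). *)
Definition renewal_count (Y : nat -> {mfun T >-> R}) (t : R) (w : T) : R :=
  fine (renewal_sup Y t w).

Let measurable_renewal_count (Y : nat -> {mfun T >-> R}) (t : R) :
  measurable_fun [set: T] (renewal_count Y t).
Proof.
suff : measurable_fun [set: T] (renewal_sup Y t).
  by move=> h; exact: (measurableT_comp (fine_measurable measurableT) h).
pose f n w : \bar R := if partial_sum Y n w <= t then n%:R%:E else -oo%E.
have -> : renewal_sup Y t = fun w => esups (f ^~ w) 0%N.
  apply/funext => w; rewrite /renewal_sup /esups /=; apply/eqP.
  rewrite eq_le; apply/andP; split.
    apply: ge_ereal_sup => _ [n /= Sn <-]; apply: ereal_sup_ubound.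
    by exists n => //; rewrite /f Sn.
  apply: ge_ereal_sup => _ [n /= _ <-]; rewrite /f; case: ifPn => [Sn|_].
    by apply: ereal_sup_ubound; exists n.
  exact: leNye.
apply: measurable_fun_esups => n; apply: measurable_fun_ifT => //.
apply: measurable_fun_ler => //.
rewrite /partial_sum; exact: measurable_sum.
Qed.

HB.instance Definition _ (Y : nat -> {mfun T >-> R}) (t : R) :=
  isMeasurableFun.Build _ _ _ _ (renewal_count Y t)
    (measurable_renewal_count Y t).

(* S_oo is the limit in \bar R of the partial sums. The terms may be negative
   on a null set, where the limit may fail to exist; the library's limit
   operator is then a fixed default value. *)
Definition discounted_series (a : R) (Z : nat -> {mfun T >-> R}) (w : T) :
    \bar R :=
  (\sum_(0 <= k <oo) (a ^- k * Z k w)%:E)%E.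

(* Whenever S_oo is not a positive real number, [fine] and [ln] return default
   values. *)
Definition limit_count (a eta : R) (Z : nat -> {mfun T >-> R}) (w : T) : R :=
  (Num.floor (- log_base a (fine (discounted_series a Z w)) + eta))%:~R.

Let measurable_discounted_series (a : R) (Z : nat -> {mfun T >-> R}) :
  measurable_fun [set: T] (discounted_series a Z).
Proof.
pose u n w := (\sum_(0 <= k < n) (a ^- k * Z k w)%:E)%E.
have mu_ n : measurable_fun [set: T] (u n).
  apply: emeasurable_sum => k; apply/measurable_EFinP.
  exact: measurable_funM.
have u_cvg w : limn_einf (u ^~ w) = limn_esup (u ^~ w) ->
    u ^~ w @ \oo --> limn_esup (u ^~ w).
  move=> e; apply: (@squeeze_cvge _ _ _ _ (einfs (u ^~ w)) (u ^~ w)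
    (esups (u ^~ w))).
  - apply: nearW => n; apply/andP; split.
      by apply: ereal_inf_lbound; exists n => /=.
    by apply: ereal_sup_ubound; exists n => /=.
  - rewrite -e limn_einf_lim; exact: is_cvg_einfs.
  - rewrite limn_esup_lim; exact: is_cvg_esups.
have -> : discounted_series a Z = fun w =>
    if limn_einf (u ^~ w) == limn_esup (u ^~ w) then limn_esup (u ^~ w)
    else point.
  apply/funext => w; rewrite /discounted_series; case: ifPn => [/eqP e|ne].
    by apply/cvg_lim => //; exact: u_cvg.
  apply: dvgP => cu; move: ne; apply/negP; rewrite negbK; apply/eqP.
  by rewrite is_cvg_limn_einfE// is_cvg_limn_esupE.
have m_sup := measurable_fun_limn_esup mu_.
apply: measurable_fun_ifT => //; apply: measurable_fun_eqe => //.
apply: measurableT_comp => //; apply: measurable_fun_limn_esup => n.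
exact: measurableT_comp.
Qed.

Let measurable_limit_count (a eta : R) (Z : nat -> {mfun T >-> R}) :
  measurable_fun [set: T] (limit_count a eta Z).
Proof.
have mfloor : measurable_fun [set: R] (fun x : R => (Num.floor x)%:~R : R).
  apply: nondecreasing_measurable => // x y xy.
  by rewrite ler_int; exact: le_floor.
apply: (measurableT_comp mfloor); apply: measurable_funD => //.
apply: measurableT_comp => //; rewrite /log_base; apply: measurable_funM => //.
apply: measurableT_comp => //; apply: measurableT_comp => //.
Qed.

HB.instance Definition _ (a eta : R) (Z : nat -> {mfun T >-> R}) :=
  isMeasurableFun.Build _ _ _ _ (limit_count a eta Z)
    (measurable_limit_count a eta Z).

End renewal.

Definition limit_law {d} {T : measurableType d} {R : realType}
    (P : probability T R) (a eta : R) (Z : nat -> {RV P >-> R}) :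
    probability R R :=
  distribution P (limit_count a eta Z).
Arguments limit_law {d T R} P a eta Z.

(* Main.v *)
Require Import Defs.
From mathcomp Require Import all_boot all_order all_algebra finmap.
From mathcomp Require Import all_classical all_reals all_analysis.
From mathcomp Require Import measurable_realfun.
From mathcomp Require Import ring lra zify.

Set Implicit Arguments.
Unset Strict Implicit.
Unset Printing Implicit Defensive.

Import Order.TTheory GRing.Theory Num.Theory.
Import numFieldNormedType.Exports.

Local Open Scope classical_set_scope.
Local Open Scope ring_scope.

(** Divide the partial sum S_m by a^m, where [a = alpha], and read it backwards:
    W_m = a^-m S_m is the sum over k < m of a^-k X_k with X_k = a^-(m-k) Y_(m-k).
    For fixed k the variable X_k converges in law to Z_k, the X_k are
    independent, and the terms with k >= K add up to a^-K W_(m-K), whose mean is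
    of order a^-K uniformly in m.  Hence W_m converges in law to the series
    S_oo of the a^-k Z_k.  As the Y_k are nonnegative, N_t >= m holds exactly
    when S_m <= t, so for an integer j and m = floor (log_a t) + j

      P (N_t - floor (log_a t) >= j) = P (W_m <= a^({log_a t} - j)),

    and along t_n the right-hand side tends to P (S_oo <= a^(eta - j)), which is
    P (floor (- log_a S_oo + eta) >= j).  That the bound varies with n does no
    harm because the law of S_oo has no atoms.  Finally, for integer-valued
    variables convergence of all these tail probabilities is weak convergence.

    The limit theorem for W_m is obtained with distribution functions only.
    [wsum_cdf_close] compares the distribution functions of two sums of
    independent variables whose terms have nearly the same interval
    probabilities: the terms are localised one after the other in narrow cells,
    and only products of finitely many cell probabilities have to be compared.
    The same localisation gives [wsum_concentration]: a sum is at most as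
    concentrated as any of its independent terms, so the absence of atoms passes
    from Z_0 to S_oo.  Together with the Markov bound [scaled_sum_tail] on the
    remainder these give [scaled_sum_cdf_cvg], the convergence of W_m.
    [pr_limit_count_ge] and [pr_renewal_count_ge] translate the two counts into
    S_oo and W_m up to null events, and [weak_cvg_integer] turns the convergence
    of tail probabilities into weak convergence. *)

(** * Probabilities as real numbers *)

(** Probabilities are finite: with values in [R] the estimates below are
    inequalities in an ordered field. *)
Definition pr {d} {T : measurableType d} {R : realType} (P : probability T R)
  (A : set T) : R := fine (P A).

Section measurable_events.
Context {d} {T : measurableType d} {R : realType} (f : T -> R).
Hypothesis mf : measurable_fun setT f.

Lemma measurable_preimage (B : set R) : measurable B -> measurable (f @^-1` B).
Proof. by move=> mB; rewrite -[X in measurable X]setTI; exact: mf. Qed.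

Lemma measurable_event_le (c : R) : measurable [set w | f w <= c].
Proof.
have := @measurable_preimage `]-oo, c] (measurable_itv _).
by congr (measurable _); apply/seteqP; split => w; rewrite /= in_itv.
Qed.

Lemma measurable_event_gt (c : R) : measurable [set w | c < f w].
Proof.
have := @measurable_preimage `]c, +oo[ (measurable_itv _).
by congr (measurable _); apply/seteqP; split => w; rewrite /= in_itv/= andbT.
Qed.

Lemma measurable_event_ge (c : R) : measurable [set w | c <= f w].
Proof.
have := @measurable_preimage `[c, +oo[ (measurable_itv _).
by congr (measurable _); apply/seteqP; split => w; rewrite /= in_itv/= andbT.
Qed.

Lemma measurable_event_oc (a b : R) : measurable [set w | a < f w <= b].
Proof.
have := @measurable_preimage `]a, b] (measurable_itv _).
by congr (measurable _); apply/seteqP; split => w; rewrite /= in_itv.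
Qed.

End measurable_events.

Section real_probability.
Context {d} {T : measurableType d} {R : realType} (P : probability T R).
Implicit Types A B C : set T.

Lemma prE A : measurable A -> (pr P A)%:E = P A.
Proof. by move=> mA; rewrite /pr fineK// fin_num_measure. Qed.

Lemma pr_ge0 A : 0 <= pr P A.
Proof. by rewrite /pr fine_ge0. Qed.

Lemma pr_le A B : measurable A -> measurable B -> A `<=` B -> pr P A <= pr P B.
Proof.
by move=> mA mB AB; rewrite -lee_fin !prE//; apply: le_measure => //; rewrite inE.
Qed.

Lemma pr_setT : pr P setT = 1.
Proof. by rewrite /pr probability_setT. Qed.

Lemma pr_set0 : pr P set0 = 0.
Proof. by rewrite /pr measure0. Qed.

Lemma pr_le1 A : measurable A -> pr P A <= 1.
Proof. by move=> mA; rewrite -pr_setT; exact: pr_le. Qed.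

Lemma pr_setU A B : measurable A -> measurable B -> A `&` B = set0 ->
  pr P (A `|` B) = pr P A + pr P B.
Proof.
move=> mA mB AB0; apply: EFin_inj; rewrite EFinD !prE//; last exact: measurableU.
by rewrite measureU.
Qed.

Lemma pr_setC A : measurable A -> pr P (~` A) = 1 - pr P A.
Proof.
move=> mA; rewrite -pr_setT -(setUv A) pr_setU ?setICr//; last exact: measurableC.
by rewrite addrC addKr.
Qed.

Lemma pr_leD A B C : measurable A -> measurable B -> measurable C ->
  A `<=` B `|` C -> pr P A <= pr P B + pr P C.
Proof.
move=> mA mB mC ABC; rewrite -lee_fin EFinD !prE//.
apply: (le_trans _ (measureU2 _ _ _)) => //.
by apply: le_measure; rewrite ?inE//; exact: measurableU.
Qed.

Lemma pr_setI_full A G : measurable A -> measurable G -> pr P (~` G) = 0 ->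
  pr P (A `&` G) = pr P A.
Proof.
move=> mA mG G0; apply/eqP; rewrite eq_le; apply/andP; split.
  by apply: pr_le => //; exact: measurableI.
rewrite -[leRHS]addr0 -G0.
apply: pr_leD => //; [exact: measurableI|exact: measurableC|].
by move=> w Aw; have [Gw|] := pselect (G w); [left|right].
Qed.

Lemma pr_eq_on A B G : measurable A -> measurable B -> measurable G ->
  pr P (~` G) = 0 -> (forall w, G w -> A w <-> B w) -> pr P A = pr P B.
Proof.
move=> mA mB mG G0 AB; rewrite -(pr_setI_full mA mG G0).
rewrite -(pr_setI_full mB mG G0); congr pr; apply/seteqP; split.
  by move=> w [/(AB _ _).1 Bw Gw]; split => //; exact: Bw.
by move=> w [/(AB _ _).2 Aw Gw]; split => //; exact: Aw.
Qed.

(** Cutting an interval of values of [f] into consecutive cells of width [h]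
    cuts every event accordingly; summing over the cells plays the part of
    conditioning on the value of [f]. *)
Lemma sum_pr_cells (f : T -> R) E (a h : R) (n : nat) : 0 <= h ->
  measurable_fun setT f -> measurable E ->
  \sum_(i < n) pr P (E `&` [set w | a + i%:R * h < f w <= a + i.+1%:R * h]) =
  pr P (E `&` [set w | a < f w <= a + n%:R * h]).
Proof.
move=> h0 mf mE; elim: n => [|n IHn].
  rewrite big_ord0 mul0r addr0 [X in pr P X](_ : _ = set0) ?pr_set0//.
  by rewrite -subset0 => w /= [_ /andP[/lt_le_trans/[apply]]]; rewrite ltxx.
have mc x y := measurable_event_oc mf x y.
rewrite big_ord_recr/= {}IHn -pr_setU; try exact: measurableI.
  have an : a <= a + n%:R * h by rewrite lerDl mulr_ge0.
  have nn : a + n%:R * h <= a + n.+1%:R * h.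
    by rewrite lerD2l ler_wpM2r// ler_nat.
  congr (pr P _); rewrite -setIUr; congr (E `&` _); apply/seteqP; split.
    move=> w /= [|] /andP[lo hi]; apply/andP; split => //.
      exact: le_trans nn.
    exact: le_lt_trans lo.
  move=> w /= /andP[lo hi]; have [le_n|gt_n] := leP (f w) (a + n%:R * h).
    by left; rewrite lo.
  by right; rewrite hi.
rewrite -subset0 => w /= [[_ /andP[_ hi]] [_ /andP[lo _]]].
by have := lt_le_trans lo hi; rewrite ltxx.
Qed.

Lemma pr_le_cells (f : T -> R) E (a h : R) (n : nat) : 0 <= h ->
  measurable_fun setT f -> measurable E ->
  pr P E <= \sum_(i < n)
      pr P (E `&` [set w | a + i%:R * h < f w <= a + i.+1%:R * h]) +
    pr P (~` [set w | a < f w <= a + n%:R * h]).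
Proof.
move=> h0 mf mE; rewrite sum_pr_cells//.
have mc x y := measurable_event_oc mf x y.
apply: pr_leD => //; [exact: measurableI|exact: measurableC|].
move=> w Ew; have [cw|] := pselect (a < f w <= a + n%:R * h); first by left.
by right.
Qed.

Lemma sum_pr_cells_le (f : T -> R) (F : nat -> set T) E (a h : R) (n : nat) :
  0 <= h -> measurable_fun setT f -> measurable E ->
  (forall i, measurable (F i)) ->
  (forall i w, F i w -> a + i%:R * h < f w <= a + i.+1%:R * h -> E w) ->
  \sum_(i < n) pr P (F i `&` [set w | a + i%:R * h < f w <= a + i.+1%:R * h])
    <= pr P E.
Proof.
move=> h0 mf mE mF FE; have mc x y := measurable_event_oc mf x y.
apply: (@le_trans _ _ (\sum_(i < n)
    pr P (E `&` [set w | a + i%:R * h < f w <= a + i.+1%:R * h]))).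
  apply: ler_sum => i _; apply: pr_le; try exact: measurableI.
  by move=> w [Fw cw]; split => //; exact: FE cw.
rewrite sum_pr_cells//; apply: pr_le => //; exact: measurableI.
Qed.

Lemma pr_tail (f : T -> R) (q : R) : 0 < q -> measurable_fun setT f ->
  exists2 M : R, 0 < M & pr P (~` [set w | - M < f w <= M]) <= q.
Proof.
move=> q0 mf.
pose A (n : nat) := ~` [set w | - n.+1%:R < f w <= n.+1%:R].
have mA n : measurable (A n) by apply: measurableC; exact: measurable_event_oc.
have capA : \bigcap_n A n = set0.
  rewrite -subset0 => w Aw.
  apply: (Aw (Num.truncn `|f w|)) => //=.
  have := truncnS_gt `|f w|; rewrite ltr_norml => /andP[-> /ltW ->] //.
have : (P \o A) x @[x --> \oo] --> P (\bigcap_n A n).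
  apply: nonincreasing_cvg_mu => //.
  - by rewrite -ge0_fin_numE// fin_num_measure.
  - exact: bigcapT_measurable.
  - move=> n m nm; apply/subsetPset; apply: subsetC => w /= /andP[lo hi].
    have nm' : n.+1%:R <= m.+1%:R :> R by rewrite ler_nat.
    by rewrite (le_trans hi)// andbT (le_lt_trans _ lo)// lerN2.
rewrite capA measure0 => /fine_cvgP[_ /cvgrPdist_le /(_ q q0) [N _ /(_ N)]].
rewrite sub0r normrN /= => /(_ (leqnn N)); rewrite ger0_norm ?fine_ge0// => Nq.
by exists N.+1%:R.
Qed.

End real_probability.

(** * The product rule for cylinder events *)

(** A cylinder event, given as a list of constraints [X i \in B]; indices in the
    list are kept distinct by the lemmas below. *)
Definition cyl {T R : Type} (X : nat -> T -> R)
    (s : seq (nat * set R)) : set T :=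
  foldr (fun p A => X p.1 @^-1` p.2 `&` A) setT s.

Fixpoint each_constraint {R : Type} (C : nat -> set R -> Prop)
    (s : seq (nat * set R)) : Prop :=
  if s is (i, B) :: s' then C i B /\ each_constraint C s' else True.

(** Independence in list form: a further constraint is added by consing, as the
    inductions on the number of summands require. *)
Definition product_rule {d} {T : measurableType d} {R : realType}
    (P : probability T R) (D : pred nat) (X : nat -> T -> R) : Prop :=
  forall s, uniq (unzip1 s) -> all D (unzip1 s) ->
    each_constraint (fun _ B => measurable B) s ->
  pr P (cyl X s) = \prod_(p <- s) pr P (X p.1 @^-1` p.2).

Section independence.
Context {d} {T : measurableType d} {R : realType} (P : probability T R).

Lemma each_constraintW (C C' : nat -> set R -> Prop) s :
  (forall i B, C i B -> C' i B) -> each_constraint C s -> each_constraint C' s.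
Proof. by move=> CC'; elim: s => [//|[i B] s IH] /= [/CC' ? /IH]. Qed.

Lemma measurable_cyl (X : nat -> T -> R) s :
  (forall k, measurable_fun setT (X k)) ->
  each_constraint (fun _ B => measurable B) s -> measurable (cyl X s).
Proof.
move=> mX; elim: s => [_|[i B] s IH]; first exact: measurableT.
move=> /= [mB ms].
by apply: measurableI; [exact: measurable_preimage|exact: IH].
Qed.

Let lookup (s : seq (nat * set R)) (i : nat) : set R :=
  foldr (fun p A => if p.1 == i then p.2 else A) setT s.

Let measurable_lookup s i :
  each_constraint (fun _ B => measurable B) s -> measurable (lookup s i).
Proof.
elim: s => [_|[j B] s IH /= [mB ms]]; first exact: measurableT.
by case: ifP => // _; exact: IH.
Qed.

Let lookup_cons (i k : nat) (B : set R) s : i \notin unzip1 s ->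
  k \in unzip1 s -> lookup ((i, B) :: s) k = lookup s k.
Proof. by move=> iN ki /=; case: eqP => // ik; rewrite ik ki in iN. Qed.

Let cylE (X : nat -> T -> R) s : uniq (unzip1 s) ->
  cyl X s = \bigcap_(i in [set k | k \in unzip1 s]) (X i @^-1` lookup s i).
Proof.
elim: s => [_|[i B] s IH /andP[iN us]].
  by apply/seteqP; split.
rewrite [LHS]/= IH//; apply/seteqP; split => w /=.
  move=> [Bw sw] k /=; rewrite inE => /predU1P[->|ki]; first by rewrite eqxx.
  by have := lookup_cons B iN ki => /= ->; exact: sw.
move=> sw; split; first by have := sw i; rewrite /= inE !eqxx; exact.
move=> k /= ki; have := sw k; rewrite /= inE ki orbT => /(_ isT).
by have := lookup_cons B iN ki => /= ->.
Qed.

Lemma independent_product_rule (D : pred nat) (Y : nat -> {RV P >-> R}) :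
  mutually_independent P [set k | D k] Y ->
  product_rule P D (fun k => Y k : T -> R).
Proof.
move=> indY s us Ds ms; pose J := seq_fset tt (unzip1 s).
have JE i : (i \in J) = (i \in unzip1 s) by rewrite seq_fsetE.
have J_sub : [set` J] `<=` [set k | D k].
  by move=> i /=; rewrite JE => /(allP Ds).
have := indY J (lookup s) J_sub (fun i _ => measurable_lookup i ms).
have -> : \bigcap_(i in [set` J]) (Y i @^-1` lookup s i) = cyl (fun k => Y k) s.
  by rewrite cylE//; apply: eq_bigcapl; split => i /=; rewrite JE.
rewrite (perm_big (unzip1 s)); last first.
  by apply: perm_trans (seq_fset_perm _ _) _; rewrite undup_id.
rewrite (eq_bigr (fun i => (pr P (Y i @^-1` lookup s i))%:E)); last first.
  by move=> i _; rewrite prE//; apply: measurable_preimage => //;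
    exact: measurable_lookup.
rewrite prodEFin => /(congr1 fine) /=; rewrite /pr => ->; rewrite -/(pr P _).
elim: s us {Ds ms J JE J_sub} => [|[i B] s IH /andP[iN us]].
  by rewrite !big_nil.
rewrite /= !big_cons/= eqxx -IH//; congr (_ * _).
apply: eq_big_seq => k ki; have := lookup_cons B iN ki => /= -> //.
Qed.

(** Needed because the sums of the limit theorem take the summands in reversed
    order and rescaled. *)
Lemma product_rule_comp (D D' : pred nat) (Y : nat -> T -> R)
    (phi : nat -> nat) (g : nat -> R -> R) :
  product_rule P D Y -> {in D' &, injective phi} ->
  {in D', forall k, D (phi k)} -> (forall k, measurable_fun setT (g k)) ->
  product_rule P D' (fun k w => g k (Y (phi k) w)).
Proof.
move=> indY phi_inj phiD mg s us Ds ms.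
pose h (p : nat * set R) := (phi p.1, g p.1 @^-1` p.2).
have -> : cyl (fun k w => g k (Y (phi k) w)) s = cyl Y (map h s).
  by elim: s {us Ds ms} => [//|p s /= ->].
have unzip_h : unzip1 (map h s) = map phi (unzip1 s).
  by rewrite /unzip1 -!map_comp.
rewrite indY ?unzip_h.
- by rewrite big_map.
- rewrite map_inj_in_uniq// => i j /(allP Ds) Di /(allP Ds) Dj.
  exact: phi_inj.
- by rewrite all_map; apply/allP => i /(allP Ds) /phiD.
- elim: s ms {us Ds unzip_h} => [//|[i B] s IH /= [mB ms]]; split; last exact: IH.
  exact: measurable_preimage.
Qed.

End independence.

(** * Distribution functions of sums of independent variables *)

Definition wsum {T : Type} {R : realType} (u : nat -> R) (X : nat -> T -> R)
  (l : seq nat) (w : T) : R := \sum_(k <- l) u k * X k w.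

Section weighted_sums.
Context {d} {T : measurableType d} {R : realType}.
Implicit Types (u : nat -> R) (X : nat -> T -> R).

Lemma wsum_nil u X w : wsum u X [::] w = 0.
Proof. by rewrite /wsum big_nil. Qed.

Lemma wsum_cons u X k l w : wsum u X (k :: l) w = u k * X k w + wsum u X l w.
Proof. by rewrite /wsum big_cons. Qed.

Lemma measurable_wsum u X l : (forall k, measurable_fun setT (X k)) ->
  measurable_fun setT (wsum u X l).
Proof.
by move=> mX; apply: measurable_sum => k; exact: measurable_funM.
Qed.

End weighted_sums.

Lemma prod_pr_itv {d} {T : measurableType d} {R : realType}
    (P : probability T R) (X : nat -> T -> R) s :
  (forall k, measurable_fun setT (X k)) ->
  each_constraint (fun _ B => measurable B) s ->
  0 <= \prod_(p <- s) pr P (X p.1 @^-1` p.2) <= 1.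
Proof.
move=> mX; elim: s => [_|[j C] s IH /= [mC ms]].
  by rewrite big_nil ler01 lexx.
have /andP[A0 A1] := IH ms; rewrite big_cons/= mulr_ge0 ?pr_ge0//=.
rewrite mulr_ile1 ?pr_ge0// pr_le1//; exact: measurable_preimage.
Qed.

Lemma fine_mesh {R : realType} (v M e : R) : 0 < e ->
  exists2 N : nat, (0 < N)%N & v * (2 * M / N%:R) <= e.
Proof.
move=> e0; exists (Num.truncn (2 * v * M / e)).+1 => //.
have := truncnS_gt (2 * v * M / e); rewrite ltr_pdivrMr// => /ltW Ne.
rewrite mulrA ler_pdivrMr ?ltr0n//; lra.
Qed.

Section sums_of_independent_variables.
Context {d d'} {T : measurableType d} {T' : measurableType d'} {R : realType}.
Context (P : probability T R) (Q : probability T' R).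
Context (X : nat -> nat -> T -> R) (V : nat -> nat -> T' -> R).
Context (D : pred nat) (u : nat -> R).
Hypothesis mX : forall m k, measurable_fun setT (X m k).
Hypothesis mV : forall m k, measurable_fun setT (V m k).
Hypothesis indX : \forall m \near \oo, product_rule P D (X m).
Hypothesis indV : \forall m \near \oo, product_rule Q D (V m).
Hypothesis u_ge0 : forall k, 0 <= u k.

Let close k (B : set R) := measurable B /\
  pr P (X m k @^-1` B) - pr Q (V m k @^-1` B) @[m --> \oo] --> (0 : R).

Hypothesis close_itv : forall k a b, D k -> close k `]a, b].
Hypothesis tightX : forall k (q : R), D k -> 0 < q -> exists2 M : R, 0 < M &
  \forall m \near \oo, pr P (~` [set w | - M < X m k w <= M]) <= q.

Let close_prod s : each_constraint close s ->
  \prod_(p <- s) pr P (X m p.1 @^-1` p.2) -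
  \prod_(p <- s) pr Q (V m p.1 @^-1` p.2) @[m --> \oo] --> (0 : R).
Proof.
elim: s => [_|[i B] s IH /= [[mB cB] cs]].
  by under eq_fun do rewrite !big_nil subrr; exact: cvg_cst.
have ms : each_constraint (fun _ B => measurable B) s.
  by apply: each_constraintW cs => j C [].
apply/cvgr0Pnorm_le => e e0; have e20 : 0 < e / 2 by rewrite divr_gt0.
have /cvgr0Pnorm_le/(_ _ e20) := cB; have /cvgr0Pnorm_le/(_ _ e20) := IH cs.
apply: filterS2 => m es eB; rewrite (splitr e).
apply: le_trans (lerD eB es).
rewrite !big_cons/=.
have /andP[] := prod_pr_itv P (mX m) ms.
set A := \prod_(j <- s) _; set B' := \prod_(j <- s) _ => A0 A1.
set a := pr P _; set b := pr Q _.
have -> : a * A - b * B' = (a - b) * A + b * (A - B') by ring.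
have b0 : 0 <= b by exact: pr_ge0.
have b1 : b <= 1 by apply: pr_le1; exact: measurable_preimage.
apply: le_trans (ler_normD _ _) _; rewrite !normrM (ger0_norm A0) (ger0_norm b0).
by apply: lerD; [exact: ler_piMr|exact: ler_piMl].
Qed.

Let close_cyl s (q : R) : uniq (unzip1 s) -> all D (unzip1 s) ->
  each_constraint close s -> 0 < q ->
  \forall m \near \oo, pr P (cyl (X m) s) <= pr Q (cyl (V m) s) + q.
Proof.
move=> us Ds cs q0.
have ms : each_constraint (fun _ B => measurable B) s.
  by apply: each_constraintW cs => i B [].
have /cvgrPdist_le/(_ q q0) := close_prod cs.
apply: filterS3 indX indV => m iX iV; rewrite iX// iV// sub0r normrN.
by rewrite -lerBlDl; exact: le_trans (ler_norm _).
Qed.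

(** Neither family is assumed to converge and both may depend on [m], so that the
    roles of [X] and [V] can be exchanged to bound a distribution function from
    either side.

    Induction on [l]: the value of the first summand is localised in a narrow
    cell, which turns this summand into one more constraint of the cylinder and
    an almost known shift of [c].  The finitely many cells that carry almost all
    of the mass of the summand are then added up. *)
Lemma wsum_cdf_close l s (c e q : R) : uniq (l ++ unzip1 s) ->
  all D (l ++ unzip1 s) -> each_constraint close s -> 0 < e -> 0 < q ->
  \forall m \near \oo,
    pr P ([set w | wsum u (X m) l w <= c] `&` cyl (X m) s) <=
    pr Q ([set w | wsum u (V m) l w <= c + e] `&` cyl (V m) s) + q.
Proof.
elim: l s c e q => [|x l IH] s c e q.
  move=> us Ds cs e0 q0; have := close_cyl us Ds cs q0; apply: filterS => m.
  have ms : each_constraint (fun _ B => measurable B) s.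
    by apply: each_constraintW cs => i B [].
  have [c0|c0] := leP 0 c => H.
    have -> : [set w | wsum u (X m) [::] w <= c] = setT.
      by apply/seteqP; split => w //= _; rewrite wsum_nil.
    have -> : [set w | wsum u (V m) [::] w <= c + e] = setT.
      by apply/seteqP; split => w //= _; rewrite wsum_nil addr_ge0// ltW.
    by rewrite !setTI.
  rewrite [X in pr P X](_ : _ = set0).
    by rewrite pr_set0 addr_ge0 ?pr_ge0// ltW.
  by rewrite -subset0 => w [/=]; rewrite wsum_nil leNgt c0.
rewrite cat_cons /= => /andP[xN ul] /andP[Dx Dl] cs e0 q0.
have ms : each_constraint (fun _ B => measurable B) s.
  by apply: each_constraintW cs => i B [].
have q20 : 0 < q / 2 by rewrite divr_gt0.
have e20 : 0 < e / 2 by rewrite divr_gt0.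
have [M M0 tailM] := tightX Dx q20.
have [N N0' uh] := fine_mesh (u x) M e20.
set h := 2 * M / N%:R in uh.
have N0 : 0 < N%:R :> R by rewrite ltr0n.
have h0 : 0 <= h by rewrite divr_ge0// ltW// mulr_gt0.
have Mh : - M + N%:R * h = M by rewrite /h; field; rewrite gt_eqF.
pose cell i := `](- M + i%:R * h), (- M + i.+1%:R * h)]%classic.
pose ci (i : nat) := c - u x * (- M + i%:R * h).
have qN0 : 0 < q / 2 / N%:R by rewrite divr_gt0.
have near_cells : \forall m \near \oo, forall i : 'I_N,
    pr P ([set w | wsum u (X m) l w <= ci i] `&` cyl (X m) ((x, cell i) :: s)) <=
    pr Q ([set w | wsum u (V m) l w <= ci i + e / 2] `&`
          cyl (V m) ((x, cell i) :: s)) + q / 2 / N%:R.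
  apply: filter_forall => i; apply: IH => //=.
  - by rewrite -cat1s uniq_catCA /= xN.
  - by rewrite all_cat /= Dx -all_cat.
  - by split => //; exact: close_itv.
move: near_cells tailM; apply: filterS2 => m cellsm tailm.
have mWX l' := measurable_wsum u l' (mX m).
have mWV l' := measurable_wsum u l' (mV m).
have cellE (f : _ -> R) i :
    f @^-1` cell i = [set w | - M + i%:R * h < f w <= - M + i.+1%:R * h].
  by apply/seteqP; split => w; rewrite /cell /= in_itv.
have mcyl := measurable_cyl (mX m) ms.
have mcylV := measurable_cyl (mV m) ms.
have mE : measurable ([set w | wsum u (X m) (x :: l) w <= c] `&` cyl (X m) s).
  by apply: measurableI => //; exact: measurable_event_le.
apply: le_trans (pr_le_cells P (- M) N h0 (mX m x) mE) _.
rewrite Mh (splitr q) addrA; apply: lerD tailm.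
apply: (@le_trans _ _ (\sum_(i < N)
    (pr Q ([set w | wsum u (V m) l w <= ci i + e / 2] `&`
       cyl (V m) ((x, cell i) :: s)) + q / 2 / N%:R))).
  apply: ler_sum => i _; apply: le_trans (cellsm i).
  apply: pr_le.
  - apply: measurableI => //; exact: measurable_event_oc.
  - apply: measurableI; first exact: measurable_event_le.
    by apply: measurableI => //; rewrite cellE; exact: measurable_event_oc.
  - move=> w [[/= Ww sw] cw]; split; last by split => //; rewrite cellE.
    rewrite /= /ci; move: Ww; rewrite wsum_cons => Ww.
    have := ler_wpM2l (u_ge0 x) (ltW (proj1 (andP cw))); lra.
rewrite big_split/= sumr_const card_ord -[X in _ + X]mulr_natr divfK ?gt_eqF//.
rewrite lerD2r.
pose F i := [set w | wsum u (V m) l w <= ci i + e / 2] `&` cyl (V m) s.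
have mE' : measurable
    ([set w | wsum u (V m) (x :: l) w <= c + e] `&` cyl (V m) s).
  by apply: measurableI => //; exact: measurable_event_le.
apply: (le_trans _ (@sum_pr_cells_le _ _ _ Q _ F _ (- M) h N h0 (mV m x) mE' _ _)).
- apply: ler_sum => i _.
  by rewrite /F -cellE /= [_ @^-1` _ `&` _]setIC setIA.
- by move=> i; apply: measurableI => //; exact: measurable_event_le.
- move=> i w [/= Ww sw] /andP[_ cw]; split => //=.
  have := ler_wpM2l (u_ge0 x) cw.
  rewrite wsum_cons; move: Ww uh; rewrite /ci -[i.+1%:R]natr1; lra.
Qed.

End sums_of_independent_variables.

(** * Concentration of sums of independent variables *)

Section concentration.
Context {d} {T : measurableType d} {R : realType} (P : probability T R).

(** Near a given point, continuity from above provides [r]; compactness makes it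
    uniform on a large interval, and tightness deals with the complement. *)
Lemma diffuse_modulus (f : T -> R) (q : R) : measurable_fun setT f ->
  (forall y, pr P [set w | f w = y] = 0) -> 0 < q ->
  exists2 r : R, 0 < r & forall a, pr P [set w | a < f w <= a + r] <= q.
Proof.
move=> mf f0 q0; have mc a b := measurable_event_oc mf a b.
have local (x : R) : exists2 r : R, 0 < r &
    pr P [set w | x - r < f w <= x + r] <= q.
  pose A (n : nat) := [set w | x - n.+1%:R^-1 < f w <= x + n.+1%:R^-1].
  have mA n : measurable (A n) by exact: mc.
  have capA : \bigcap_n A n = [set w | f w = x].
    apply/seteqP; split => w /=.
      move=> Aw; apply/eqP; rewrite -subr_eq0 -normr_le0; apply/ler_addgt0Pl.
      move=> e e0; rewrite addr0; have := Aw (Num.truncn e^-1) I => /= /andP[lo hi].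
      have : (Num.truncn e^-1).+1%:R^-1 <= e.
        rewrite -[leRHS]invrK lef_pV2 ?posrE ?ltr0n ?invr_gt0//.
        exact/ltW/truncnS_gt.
      move: lo hi; move: (_.+1%:R^-1) => y *.
      by rewrite ler_norml; apply/andP; split; lra.
    move=> fwx n _; rewrite /A /= fwx ltrBlDr ltrDl lerDl.
    by rewrite invr_gt0 invr_ge0 ltr0n ler0n.
  have : (P \o A) x @[x --> \oo] --> P (\bigcap_n A n).
    apply: nonincreasing_cvg_mu => //.
    - by rewrite -ge0_fin_numE// fin_num_measure.
    - exact: bigcapT_measurable.
    - move=> n m nm; apply/subsetPset => w /= /andP[lo hi].
      have nm' : m.+1%:R^-1 <= n.+1%:R^-1 :> R.
        by rewrite lef_pV2 ?posrE ?ltr0n// ler_nat.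
      move: nm' lo hi; rewrite /A /=.
      move: (m.+1%:R^-1) (n.+1%:R^-1) => y z zy lo hi.
      by apply/andP; split; lra.
  have mfx : measurable [set w | f w = x].
    by rewrite -capA; exact: bigcapT_measurable.
  rewrite capA -(prE P mfx) f0.
  move=> /fine_cvgP[_ /cvgr0Pnorm_le /(_ q q0) [N _ /(_ N (leqnn N))]] /=.
  rewrite ger0_norm ?fine_ge0// => Nq.
  by exists N.+1%:R^-1; rewrite ?invr_gt0 ?ltr0n.
have [M M0 tail] := pr_tail P q0 mf.
have loc a : `[- M - 1, M]%classic a -> \forall a' \near a & r \near 0^'+,
    pr P [set w | a' < f w <= a' + r] <= q.
  move=> _; have [r r0 ar] := local a.
  have r20 : 0 < r / 2 by rewrite divr_gt0.
  exists ([set a' | `|a - a'| < r / 2], [set r' | r' < r / 2]) => /=.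
    split; first by exists (r / 2).
    by exists (r / 2) => //= y /= + y0; rewrite sub0r normrN gtr0_norm.
  move=> [a' r'] /= [a'r r'r]; apply: le_trans ar; apply: pr_le => // w /=.
  by move: a'r; rewrite ltr_norml => /andP[? ?] /andP[? ?]; apply/andP; split; lra.
have /compact_near_coveringP cK := @segment_compact R (- M - 1) M.
have [r /= r0 unif] := cK _ _ (fun r a => pr P [set w | a < f w <= a + r] <= q)
  _ loc.
pose r1 := Num.min (r / 2) 1.
have r1_gt0 : 0 < r1 by rewrite /r1 lt_min divr_gt0//=.
have r1r : r1 < r.
  by rewrite /r1 gt_min; apply/orP; left; lra.
have r1_le1 : r1 <= 1 by rewrite /r1 ge_min lexx orbT.
exists r1 => // a; have [aM|aM] := boolP (a \in `[- M - 1, M]).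
  by apply: unif => //=; rewrite sub0r normrN gtr0_norm.
apply: le_trans tail; apply: pr_le => //; first exact: measurableC.
move=> w /= /andP[lo hi] /andP[lo' hi']; move/negP: aM; apply.
by rewrite in_itv/=; apply/andP; split; lra.
Qed.

Context (X : nat -> T -> R) (D : pred nat) (u : nat -> R).
Hypothesis mX : forall k, measurable_fun setT (X k).
Hypothesis indX : product_rule P D X.
Hypothesis u_ge0 : forall k, 0 <= u k.

(** The summands of [l] are localised in narrow cells one after the other.  Once
    all of them are almost known they only shift [c], and the bound on the term
    of index [x0] holds at every place.  The gap between [e] and [r] absorbs the
    widths of the cells. *)
Let wsum_concentration_cyl x0 (r q : R) l s (c e : R) :
  (forall a, pr P [set w | a < u x0 * X x0 w <= a + r] <= q) ->
  uniq (x0 :: l ++ unzip1 s) -> all D (x0 :: l ++ unzip1 s) ->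
  each_constraint (fun _ B => measurable B) s -> e < r ->
  pr P ([set w | c < wsum u X (x0 :: l) w <= c + e] `&` cyl X s) <=
  q * pr P (cyl X s).
Proof.
move=> conc; elim: l s c e => [|x l IH] s c e.
  move=> /= /andP[x0s us] /andP[Dx Ds] ms er.
  have mu0 : measurable_fun setT (fun y : R => u x0 * y) by exact: measurable_funM.
  pose B := [set y | c < u x0 * y <= c + e].
  have mB : measurable B by exact: measurable_event_oc.
  have -> : [set w | c < wsum u X [:: x0] w <= c + e] `&` cyl X s =
      cyl X ((x0, B) :: s).
    by apply/seteqP; split => w /=; rewrite wsum_cons wsum_nil addr0.
  rewrite indX//=; last by rewrite Dx.
    rewrite big_cons -indX// ler_wpM2r ?pr_ge0//; apply: le_trans (conc c).
    apply: pr_le.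
    - exact: measurable_preimage.
    - by apply: measurable_event_oc; exact: measurable_funM.
    - by move=> w /= /andP[-> /=]; lra.
  by rewrite x0s.
move=> us Ds ms er; apply/ler_addgt0Pr => t t0.
have mW l' := measurable_wsum u l' mX.
have [M M0 tail] := pr_tail P t0 (mX x).
have re0 : 0 < (r - e) / 2 by rewrite divr_gt0// subr_gt0.
have [N N0' uh] := fine_mesh (u x) M re0.
set h := 2 * M / N%:R in uh.
have N0 : 0 < N%:R :> R by rewrite ltr0n.
have h0 : 0 <= h by rewrite divr_ge0// ltW// mulr_gt0.
have Mh : - M + N%:R * h = M by rewrite /h; field; rewrite gt_eqF.
have mcyl := measurable_cyl mX ms.
have mE : measurable
    ([set w | c < wsum u X (x0 :: x :: l) w <= c + e] `&` cyl X s).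
  by apply: measurableI => //; exact: measurable_event_oc.
apply: le_trans (pr_le_cells P (- M) N h0 (mX x) mE) _.
rewrite Mh; apply: lerD tail.
pose cell i := `](- M + i%:R * h), (- M + i.+1%:R * h)]%classic.
have cellE (f : _ -> R) i :
    f @^-1` cell i = [set w | - M + i%:R * h < f w <= - M + i.+1%:R * h].
  by apply/seteqP; split => w; rewrite /cell /= in_itv.
apply: (@le_trans _ _ (\sum_(i < N) q * pr P (cyl X ((x, cell i) :: s)))).
  apply: ler_sum => i _.
  pose ci := c - u x * (- M + i.+1%:R * h).
  apply: le_trans (IH ((x, cell i) :: s) ci (e + u x * h) _ _ _ _).
  - apply: pr_le.
    + apply: measurableI => //; exact: measurable_event_oc.
    + apply: measurableI; first exact: measurable_event_oc.
      by apply: measurableI => //; rewrite cellE; exact: measurable_event_oc.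
    + move=> w [[/= Ww sw] cw]; split; last by split => //; rewrite cellE.
      have /andP[/ltW cl ch] := cw.
      have := ler_wpM2l (u_ge0 x) cl; have := ler_wpM2l (u_ge0 x) ch.
      rewrite /= /ci; move: Ww; rewrite !wsum_cons -[i.+1%:R]natr1.
      by move=> /andP[? ?] ? ?; apply/andP; split; lra.
  - move: us; rewrite /= -[x :: unzip1 s]cat1s uniq_catCA /= !inE !mem_cat.
    by rewrite !inE orbCA.
  - by move: Ds; rewrite /= !all_cat /= => /and4P[-> -> -> ->].
  - by split => //; exact: measurable_itv.
  - lra.
rewrite -mulr_sumr; apply: ler_wpM2l; first exact: le_trans (pr_ge0 _ _) (conc 0).
apply: (le_trans _ (@sum_pr_cells_le _ _ _ P (X x) (fun=> cyl X s) (cyl X s)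
  (- M) h N h0 (mX x) mcyl _ _)) => //.
by apply: ler_sum => i _; rewrite -cellE /= setIC.
Qed.

Lemma wsum_concentration x0 (r q : R) l (c e : R) :
  (forall a, pr P [set w | a < u x0 * X x0 w <= a + r] <= q) ->
  uniq (x0 :: l) -> all D (x0 :: l) -> e < r ->
  pr P [set w | c < wsum u X (x0 :: l) w <= c + e] <= q.
Proof.
move=> conc ul Dl er.
have := @wsum_concentration_cyl x0 r q l [::] c e conc.
by rewrite /= cats0 setIT pr_setT mulr1; exact.
Qed.

End concentration.

(** * Distribution functions under weak convergence *)

Section weak_convergence.
Context {R : realType}.

Definition ramp (c r y : R) : R := Num.min 1 (Num.max 0 ((c + r - y) / r)).

Lemma continuous_ramp c r : continuous (ramp c r).
Proof.
move=> y; apply: (@continuous_min R R (cst 1) _ y); first exact: cst_continuous.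
apply: (@continuous_max R R (cst 0) _ y); first exact: cst_continuous.
apply: cvgM; last exact: cvg_cst.
by apply: cvgB; [exact: cvg_cst|exact: cvg_id].
Qed.

Lemma ramp_itv c r y : 0 <= ramp c r y <= 1.
Proof. by rewrite /ramp le_min ler01 le_max lexx ge_min lexx. Qed.

Lemma ramp_eq1 c r y : 0 < r -> y <= c -> ramp c r y = 1.
Proof.
move=> r0 yc; have : 1 <= (c + r - y) / r by rewrite ler_pdivlMr//; lra.
by move=> h; rewrite /ramp; apply/min_idPl; rewrite le_max h orbT.
Qed.

Lemma ramp_eq0 c r y : 0 < r -> c + r <= y -> ramp c r y = 0.
Proof.
move=> r0 yc; have : (c + r - y) / r <= 0 by rewrite ler_pdivrMr// mul0r; lra.
by move=> h; rewrite /ramp (max_idPl h); apply/min_idPr.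
Qed.

Lemma bounded_ramp c r : bounded_fun (ramp c r).
Proof.
exists 1; split => // x x1 y _; have /andP[r0 r1] := ramp_itv c r y.
by rewrite /= ger0_norm// (le_trans r1)// ltW.
Qed.

Lemma measurable_ramp c r : measurable_fun setT (ramp c r).
Proof. by apply: continuous_measurable_fun; exact: continuous_ramp. Qed.

(** The ramp is a continuous test function between the indicators of two
    half-lines. *)
Lemma ramp_integral (mu : probability R R) c r : 0 < r ->
  ((pr mu `]-oo, c])%:E <= \int[mu]_x (ramp c r x)%:E)%E /\
  (\int[mu]_x (ramp c r x)%:E <= (pr mu `]-oo, (c + r)])%:E)%E.
Proof.
move=> r0; have mr := measurable_ramp c r.
rewrite !prE; [|exact: measurable_itv|exact: measurable_itv].
have muE x : mu `]-oo, x]%classic = (\int[mu]_y (\1_(`]-oo, x]%classic) y)%:E)%E.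
  by rewrite integral_indic ?setIT.
have mind x : measurable_fun setT (fun y : R => (\1_(`]-oo, x]%classic) y)%:E).
  by apply/measurable_EFinP; exact: measurable_indic.
have mrE : measurable_fun setT (fun y : R => (ramp c r y)%:E).
  exact/measurable_EFinP.
rewrite !muE; split; apply: ge0_le_integral => //=.
- move=> x _; rewrite lee_fin indicE; have /andP[x0 x1] := ramp_itv c r x.
  by case: (boolP (x \in _)) => //; rewrite inE/= in_itv/= => xc; rewrite ramp_eq1.
- by move=> x _; rewrite lee_fin; case/andP: (ramp_itv c r x).
- move=> x _; rewrite lee_fin indicE; have /andP[x0 x1] := ramp_itv c r x.
  case: (boolP (x \in _)) => //; rewrite notin_setE/= in_itv/= => /negP.
  by rewrite -ltNge => /ltW xc; rewrite ramp_eq0.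
Qed.

Context (mu_ : nat -> probability R R) (mu : probability R R).
Hypothesis mu_cvg : weak_cvg mu_ mu.

Let ramp_close c r q : 0 < q -> 0 < r -> \forall n \near \oo,
  `|fine (\int[mu]_x (ramp c r x)%:E) - fine (\int[mu_ n]_x (ramp c r x)%:E)|
  <= q.
Proof.
move=> q0 r0.
have := mu_cvg (continuous_ramp (c := c) (r := r)) (bounded_ramp c r).
have [lo hi] := ramp_integral mu c r0.
have mufin : (\int[mu]_x (ramp c r x)%:E)%E \is a fin_num.
  rewrite ge0_fin_numE; first by rewrite (le_lt_trans hi)// ltry.
  by apply: le_trans lo; rewrite lee_fin pr_ge0.
by rewrite -{1}(fineK mufin) => /fine_cvgP[_ /cvgrPdist_le/(_ q q0)].
Qed.

Let fine_ramp (nu : probability R R) c r : 0 < r ->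
  pr nu `]-oo, c] <= fine (\int[nu]_x (ramp c r x)%:E) <=
  pr nu `]-oo, (c + r)].
Proof.
move=> r0; have [lo hi] := ramp_integral nu c r0.
have nufin : (\int[nu]_x (ramp c r x)%:E)%E \is a fin_num.
  rewrite ge0_fin_numE; first by rewrite (le_lt_trans hi)// ltry.
  by apply: le_trans lo; rewrite lee_fin pr_ge0.
by apply/andP; split; rewrite -lee_fin (fineK nufin).
Qed.

Lemma weak_cvg_cdf c r q : 0 < r -> 0 < q -> \forall n \near \oo,
  pr (mu_ n) `]-oo, c] <= pr mu `]-oo, (c + r)] + q /\
  pr mu `]-oo, c] <= pr (mu_ n) `]-oo, (c + r)] + q.
Proof.
move=> r0 q0; have := ramp_close c q0 r0; apply: filterS => n.
have /andP[? ?] := fine_ramp mu c r0; have /andP[? ?] := fine_ramp (mu_ n) c r0.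
by rewrite ler_norml => /andP[? ?]; split; lra.
Qed.

(** Carries the nonnegativity of the scaled summands over to their limit. *)
Lemma weak_cvg_lt0 :
  (forall c, c < 0 -> \forall n \near \oo, pr (mu_ n) `]-oo, c] = 0) ->
  forall c, c < 0 -> pr mu `]-oo, c] = 0.
Proof.
move=> mun0 c c0; apply/eqP; rewrite eq_le pr_ge0 andbT.
apply/ler_addgt0Pr => q q0; rewrite add0r.
have c20 : 0 < - c / 2 by rewrite divr_gt0// oppr_gt0.
have cc : c + - c / 2 < 0 by lra.
have [n [[_ hi] eq0]] : exists n,
  (pr (mu_ n) `]-oo, c] <= pr mu `]-oo, (c + - c / 2)] + q /\
   pr mu `]-oo, c] <= pr (mu_ n) `]-oo, (c + - c / 2)] + q) /\
  pr (mu_ n) `]-oo, (c + - c / 2)] = 0.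
  by near \oo => n; exists n; split; near: n; [exact: weak_cvg_cdf|exact: mun0].
by apply: le_trans hi _; rewrite eq0 add0r.
Unshelve. all: end_near. Qed.

Hypothesis mu_diffuse : forall y, pr mu [set y] = 0.

Lemma diffuse_cdf_modulus (q : R) : 0 < q ->
  exists2 r : R, 0 < r & forall c, pr mu `]-oo, (c + r)] <= pr mu `]-oo, c] + q.
Proof.
move=> q0; have [r r0 rq] :=
  @diffuse_modulus _ _ _ mu idfun q (@measurable_id _ _ _) mu_diffuse q0.
exists r => // c.
apply: le_trans (_ : _ <= pr mu `]-oo, c] +
  pr mu [set y | c < y <= c + r]) _.
  apply: pr_leD; try exact: measurable_itv.
    exact: (@measurable_event_oc _ _ _ idfun (@measurable_id _ _ _)).
  by move=> y /=; rewrite !in_itv/=; case: (leP y c) => ? ?; [left|right].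
by rewrite lerD2l; exact: rq.
Qed.

Lemma weak_cvg_itv a b :
  pr (mu_ n) `]a, b] - pr mu `]a, b] @[n --> \oo] --> (0 : R).
Proof.
have cdf_cvg c q : 0 < q -> \forall n \near \oo,
    `|pr (mu_ n) `]-oo, c] - pr mu `]-oo, c]| <= q.
  move=> q0; have q20 : 0 < q / 2 by rewrite divr_gt0.
  have [r r0 rq] := diffuse_cdf_modulus q20.
  have := weak_cvg_cdf c r0 q20; have := weak_cvg_cdf (c - r) r0 q20.
  apply: filterS2 => n [_ +] [+ _]; rewrite subrK => lo hi.
  have := rq c; have := rq (c - r); rewrite subrK ler_norml => ? ?.
  by apply/andP; split; lra.
have [ab|ba] := leP a b; last first.
  have -> : `]a, b]%classic = set0 :> set R.
    by rewrite -subset0 => y /=; rewrite in_itv/= => /andP[? ?]; lra.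
  under eq_fun do rewrite !pr_set0 subrr; exact: cvg_cst.
have itvE (nu : probability R R) :
    pr nu `]a, b] = pr nu `]-oo, b] - pr nu `]-oo, a].
  have -> : `]-oo, b]%classic = `]-oo, a] `|` `]a, b].
    apply/seteqP; split => y /=; rewrite !in_itv/=.
      by move=> yb; case: (leP y a) => ?; [left|right].
    by move=> [|/andP[]//] ya; exact: le_trans ab.
  rewrite pr_setU; [|exact: measurable_itv|exact: measurable_itv|].
    by rewrite addrC addKr.
  by rewrite -subset0 => y [] /=; rewrite !in_itv/= => ? /andP[? _]; lra.
apply/cvgr0Pnorm_le => q q0; have q20 : 0 < q / 2 by rewrite divr_gt0.
have := cdf_cvg b _ q20; have := cdf_cvg a _ q20.
apply: filterS2 => n; rewrite !itvE !ler_norml => /andP[? ?] /andP[? ?].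
by apply/andP; split; lra.
Qed.

End weak_convergence.

(** * Tails of the scaled partial sums *)

Lemma expV_mul_cvg0 {R : realType} (a c : R) : 1 < a ->
  a ^- n * c @[n --> \oo] --> (0 : R).
Proof.
move=> a1; have a0 : 0 < a by exact: lt_trans a1.
rewrite -[X in _ --> X](mul0r c); apply: cvgMl.
under eq_fun do rewrite -exprVn; apply: cvg_expr.
by rewrite ger0_norm ?invr_ge0 ?ltW// invf_lt1.
Qed.

Definition scaled_sum {T : Type} {R : realType} (a : R) (Y : nat -> T -> R)
  (m : nat) (w : T) : R := a ^- m * \sum_(1 <= k < m.+1) Y k w.

Section mean_bound.
Context {d} {T : measurableType d} {R : realType} (P : probability T R).
Context (a : R) (Y : nat -> T -> R).
Hypothesis a_gt1 : 1 < a.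
Hypothesis mY : forall k, measurable_fun setT (Y k).
Hypothesis Y_ge0 : forall k, (1 <= k)%N -> forall w, 0 <= Y k w.

Let a_gt0 : 0 < a. Proof. exact: lt_trans a_gt1. Qed.

Lemma measurable_scaled_sum m : measurable_fun setT (scaled_sum a Y m).
Proof. by apply: measurable_funM => //; exact: measurable_sum. Qed.

Lemma scaled_sum_ge0 m w : 0 <= scaled_sum a Y m w.
Proof.
rewrite mulr_ge0 ?invr_ge0 ?exprn_ge0 ?(ltW a_gt0)//.
by rewrite big_nat_cond sumr_ge0// => k /andP[/andP[k1 _] _]; exact: Y_ge0.
Qed.

(** Markov's inequality; the means of the scaled sums are dominated by a
    geometric series. *)
Lemma scaled_sum_tail (B : R) : 0 <= B ->
  (forall k, (1 <= k)%N -> (\int[P]_w (Y k w)%:E <= (B * a ^+ k)%:E)%E) ->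
  forall m x, 0 < x ->
  pr P [set w | x < scaled_sum a Y m w] <= B * (a / (a - 1)) / x.
Proof.
move=> B0 EY m x x0; set C := B * _.
have a1 : 0 < a - 1 by rewrite subr_gt0.
pose S (w : T) := \sum_(1 <= k < m.+1) Y k w.
have mS : measurable_fun setT S by exact: measurable_sum.
have S0 w : 0 <= S w.
  by rewrite /S big_nat_cond sumr_ge0// => k /andP[/andP[k1 _] _]; exact: Y_ge0.
have ES : (\int[P]_w (S w)%:E <= (C * a ^+ m)%:E)%E.
  have SE w : (S w)%:E = (\sum_(i < m) (Y i.+1 w)%:E)%E.
    by rewrite sumEFin /S big_add1 big_mkord.
  rewrite (eq_integral (fun w => \sum_(i < m) (Y i.+1 w)%:E)%E); last first.
    by move=> w _; exact: SE.
  rewrite ge0_integral_sum//; last 2 first.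
  - by move=> i; exact/measurable_EFinP.
  - by move=> i w _; rewrite lee_fin Y_ge0.
  apply: (@le_trans _ _ (\sum_(i < m) (B * a ^+ i.+1)%:E)%E).
    by apply: lee_sum => i _; exact: EY.
  rewrite sumEFin lee_fin -mulr_sumr /C -mulrA ler_wpM2l//.
  elim: m {S mS S0 SE} => [|m IH].
    by rewrite big_ord0 mulr_ge0// divr_ge0// ltW.
  rewrite big_ord_recr/=.
  apply: le_trans (lerD IH (lexx _)) _.
  rewrite exprS le_eqVlt; apply/orP; left; apply/eqP; field.
  by rewrite gt_eqF.
set A := [set w | _ < _].
have am0 : 0 < a ^+ m by exact: exprn_gt0.
have mA : measurable A.
  exact: measurable_event_gt (measurable_scaled_sum m) x.
rewrite ler_pdivlMr// mulrC -(ler_pM2r am0) -lee_fin.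
apply: le_trans ES; rewrite mulrAC EFinM prE// -integral_cst//.
apply: le_trans (_ : _ <= \int[P]_(w in A) (S w)%:E)%E _.
  apply: ge0_le_integral => //=.
  - by move=> w _; rewrite lee_fin mulr_ge0// ltW.
  - by apply/measurable_EFinP; exact: measurable_funTS.
  - move=> w; rewrite /A /scaled_sum /= -/(S w) lee_fin => /ltW.
    by rewrite mulrC ler_pdivlMr.
apply: ge0_subset_integral => //=; first exact/measurable_EFinP.
by move=> w _; rewrite lee_fin.
Qed.

End mean_bound.

(** The convergence of the means enters only here, to provide the constant of
    [scaled_sum_tail]. *)
Lemma scaled_means_bounded {d} {T : measurableType d} {R : realType}
    (P : probability T R) (a l : R) (Y : nat -> {RV P >-> R}) : 0 < a ->
  (forall k, (1 <= k)%N -> P.-integrable setT (EFin \o Y k)) ->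
  ((a ^- k)%:E * 'E_P[Y k])%E @[k --> \oo] --> l%:E ->
  exists2 B : R, 0 <= B & forall k, (1 <= k)%N ->
    (\int[P]_w (Y k w)%:E <= (B * a ^+ k)%:E)%E.
Proof.
move=> a0 Yint; rewrite unlock => EY.
pose y k := a ^- k * fine (\int[P]_w (Y k w)%:E).
have yE k : (1 <= k)%N ->
    ((a ^- k)%:E * \int[P]_w (Y k w)%:E)%E = (y k)%:E.
  move=> k1; rewrite /y EFinM fineK//; apply: integrable_fin_num => //.
  exact: Yint.
have y_cvg : y k @[k --> \oo] --> l.
  have /fine_cvgP[_] := EY; apply: cvg_trans; apply: near_eq_cvg.
  by exists 1%N => // k /= k1; rewrite yE.
have [B [_ yB]] := cvg_seq_bounded (cvgP _ y_cvg).
exists (`|B| + 1) => [|k k1]; first by rewrite addr_ge0.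
have := yB (`|B| + 1) _ k I; rewrite /= => /(_ _)/(le_trans (ler_norm _)).
have Bb : B < `|B| + 1 by rewrite ltr_pwDr// ler_norm.
move=> /(_ Bb) yk.
have ak : 0 < a ^+ k by exact: exprn_gt0.
rewrite -[leLHS]fineK; last by apply: integrable_fin_num => //; exact: Yint.
by rewrite lee_fin; move: yk; rewrite /y mulrC ler_pdivrMr.
Qed.

(** * The limit of the scaled partial sums *)

Section limit_of_scaled_sums.
Context {d d'} {T : measurableType d} {T' : measurableType d'} {R : realType}.
Context (P : probability T R) (Q : probability T' R).
Context (a C : R) (Y : nat -> T -> R) (Z : nat -> T' -> R).
Hypothesis a_gt1 : 1 < a.
Hypothesis mY : forall k, measurable_fun setT (Y k).
Hypothesis Y_ge0 : forall k, (1 <= k)%N -> forall w, 0 <= Y k w.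
Hypothesis indY : product_rule P [pred k | (1 <= k)%N] Y.
Hypothesis mZ : forall k, measurable_fun setT (Z k).
Hypothesis Z_gt0 : forall k, pr Q [set w | Z k w <= 0] = 0.
Hypothesis Z_diffuse : forall y, pr Q [set w | Z 0%N w = y] = 0.
Hypothesis indZ : product_rule Q predT Z.
Hypothesis YZ : forall k x y,
  pr P [set w | x < a ^- m * Y m w <= y] - pr Q [set w | x < Z k w <= y]
    @[m --> \oo] --> (0 : R).
Hypothesis tailY : forall m x, 0 < x ->
  pr P [set w | x < scaled_sum a Y m w] <= C / x.

Let a_gt0 : 0 < a. Proof. exact: lt_trans a_gt1. Qed.

Let u (k : nat) : R := a ^- k.
Let u_ge0 k : 0 <= u k. Proof. by rewrite invr_ge0 exprn_ge0// ltW. Qed.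

(** Time is reversed: the last of the first [m] summands gets index [0], so that
    each index has its own limit variable. *)
Let X (m k : nat) (w : T) : R := a ^- (m - k) * Y (m - k) w.

Let mX m k : measurable_fun setT (X m k).
Proof. exact: measurable_funM. Qed.

Lemma scaled_sum_split m K w : (K <= m)%N -> scaled_sum a Y m w =
  wsum u (X m) (iota 0 K) w + a ^- K * scaled_sum a Y (m - K) w.
Proof.
elim: K => [|K IH] Km; first by rewrite wsum_nil add0r invr1 mul1r subn0.
rewrite IH; last exact: ltnW.
rewrite -[K.+1 in RHS]addn1 iotaD add0n /wsum big_cat/= big_seq1 -addrA.
congr (_ + _); rewrite /u /X /scaled_sum addn1 subnS.
have [n ->] : exists n, (m - K = n.+1)%N by exists (m - K).-1; lia.
rewrite big_nat_recr//= mulrDr addrC mulrDr; congr (_ + _).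
rewrite !mulrA -!invfM; congr (_^-1 * _).
by rewrite -!exprD addnS addSn.
Qed.

Let indX K : \forall m \near \oo, product_rule P [pred k | (k < K)%N] (X m).
Proof.
exists K => // m /= Km.
apply: (@product_rule_comp _ _ _ P [pred k | (1 <= k)%N] _ Y (fun k => (m - k)%N)
  (fun k y => a ^- (m - k) * y) indY).
- by move=> i j; rewrite !inE/=; lia.
- by move=> i; rewrite !inE/=; lia.
- by move=> k; exact: measurable_funM.
Qed.

Let preimage_itv {S : Type} (f : S -> R) x y :
  f @^-1` `]x, y] = [set w | x < f w <= y].
Proof. by apply/seteqP; split => w; rewrite /= in_itv. Qed.

Let XZ k x y :
  pr P (X m k @^-1` `]x, y]) - pr Q (Z k @^-1` `]x, y]) @[m --> \oo] --> (0 : R).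
Proof.
apply/cvgr0Pnorm_le => q q0; have /cvgr0Pnorm_le/(_ q q0)[N _ NYZ] := YZ k x y.
exists (N + k)%N => // m /= Nm; rewrite !preimage_itv; apply: NYZ => /=.
by rewrite leq_subRL//; lia.
Qed.

Let tightX k (q : R) : 0 < q -> exists2 M : R, 0 < M &
  \forall m \near \oo, pr P (~` [set w | - M < X m k w <= M]) <= q.
Proof.
move=> q0; have q20 : 0 < q / 2 by rewrite divr_gt0.
have [M M0 tail] := pr_tail Q q20 (mZ k); exists M => //.
have /cvgr0Pnorm_le/(_ _ q20) := XZ k (- M) M; apply: filterS => m.
rewrite !preimage_itv ler_norml; move: tail.
rewrite !pr_setC; [|exact: measurable_event_oc|exact: measurable_event_oc].
by move=> ? /andP[? ?]; lra.
Qed.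

Definition partial_cdf (K : nat) (x : R) : R :=
  pr Q [set w | wsum u Z (iota 0 K) w <= x].

Let mwZ K : measurable_fun setT (wsum u Z (iota 0 K)).
Proof. exact: measurable_wsum. Qed.

Let mwX m K : measurable_fun setT (wsum u (X m) (iota 0 K)).
Proof. by apply: measurable_wsum => k. Qed.

Let mS m : measurable_fun setT (scaled_sum a Y m).
Proof. exact: measurable_scaled_sum. Qed.

Let S_ge0 m w : 0 <= scaled_sum a Y m w.
Proof. exact: scaled_sum_ge0. Qed.

(** Dropping all terms but the first [K] can only lower the sum. *)
Lemma scaled_sum_cdf_le K c e q : 0 < e -> 0 < q -> \forall m \near \oo,
  pr P [set w | scaled_sum a Y m w <= c] <= partial_cdf K (c + e) + q.
Proof.
move=> e0 q0.
have : \forall m \near \oo, pr P ([set w | wsum u (X m) (iota 0 K) w <= c]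
      `&` cyl (X m) [::]) <=
    pr Q ([set w | wsum u Z (iota 0 K) w <= c + e] `&` cyl Z [::]) + q.
  apply: (@wsum_cdf_close _ _ _ _ _ P Q X (fun=> Z) [pred k | (k < K)%N]) => //.
  - apply: nearW => m; exact: (@product_rule_comp _ _ _ Q predT _ Z id (fun=> id)).
  - by move=> k q' _; exact: tightX.
  - by rewrite cats0 iota_uniq.
  - by rewrite cats0; apply/allP => k; rewrite mem_iota.
apply: filter_app; exists K => // m /= Km; rewrite !setIT.
apply: le_trans; apply: pr_le; try exact: measurable_event_le.
move=> w /=; apply: le_trans; rewrite (scaled_sum_split w Km).
by rewrite lerDl mulr_ge0// u_ge0.
Qed.

(** The terms beyond the first [K] add up to [a ^- K] times an earlier scaled sum
    and exceed [e] with small probability; the other [e] pays for the passage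
    from the [X m k] to the [Z k]. *)
Lemma scaled_sum_cdf_ge K c e q : 0 < e -> 0 < q -> \forall m \near \oo,
  partial_cdf K (c - e - e) <=
  pr P [set w | scaled_sum a Y m w <= c] + q + a ^- K * (C / e).
Proof.
move=> e0 q0.
have : \forall m \near \oo,
    pr Q ([set w | wsum u Z (iota 0 K) w <= c - e - e] `&` cyl Z [::]) <=
    pr P ([set w | wsum u (X m) (iota 0 K) w <= c - e - e + e]
      `&` cyl (X m) [::]) + q.
  apply: (@wsum_cdf_close _ _ _ _ _ Q P (fun=> Z) X [pred k | (k < K)%N]) => //.
  - apply: nearW => m; exact: (@product_rule_comp _ _ _ Q predT _ Z id (fun=> id)).
  - move=> k x y _; split; first exact: measurable_itv.
    by apply/cvgr0Pnorm_le => r r0; have /cvgr0Pnorm_le/(_ r r0) := XZ k x y;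
       apply: filterS => m; rewrite distrC.
  - move=> k q' _ q'0; have [M M0 tail] := pr_tail Q q'0 (mZ k).
    by exists M => //; exact: nearW.
  - by rewrite cats0 iota_uniq.
  - by rewrite cats0; apply/allP => k; rewrite mem_iota.
apply: filter_app; exists K => // m /= Km; rewrite !setIT subrK => ZX.
apply: le_trans ZX _; rewrite addrAC lerD2r.
pose A := [set w | a ^+ K * e < scaled_sum a Y (m - K) w].
have mA : measurable A by exact: measurable_event_gt.
apply: le_trans (_ : _ <= pr P [set w | scaled_sum a Y m w <= c] + pr P A) _.
  apply: pr_leD => //; try exact: measurable_event_le.
  move=> w /= Xw; rewrite /A /= (scaled_sum_split w Km).
  have [|Sw] := ltP (a ^+ K * e) (scaled_sum a Y (m - K) w); first by right.
  left; rewrite -[leRHS](subrK e); apply: lerD => //.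
  by rewrite mulrC ler_pdivrMr ?exprn_gt0// mulrC.
rewrite lerD2l; apply: le_trans (tailY _ _) _.
  by rewrite mulr_gt0// exprn_gt0.
by rewrite invfM mulrCA.
Qed.

(** The distribution function of the limit series, written without limits in
    the space of outcomes: almost surely the partial sums increase. *)
Definition limit_cdf (x : R) : R :=
  pr Q (\bigcap_K [set w | wsum u Z (iota 0 K) w <= x]).

Let mE K x : measurable [set w | wsum u Z (iota 0 K) w <= x].
Proof. exact: measurable_event_le. Qed.

Let mEoo x : measurable (\bigcap_K [set w | wsum u Z (iota 0 K) w <= x]).
Proof. exact: bigcapT_measurable. Qed.

Definition positive_terms : set T' := \bigcap_k [set w | 0 < Z k w].

Let setC_le0 k : [set w | 0 < Z k w] = ~` [set w | Z k w <= 0].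
Proof. by apply/seteqP; split => w /=; rewrite ltNge => /negP. Qed.

Lemma measurable_positive_terms : measurable positive_terms.
Proof.
apply: bigcapT_measurable => k; rewrite setC_le0.
by apply: measurableC; exact: measurable_event_le.
Qed.

Lemma pr_positive_terms : pr Q (~` positive_terms) = 0.
Proof.
have mN := measurableC measurable_positive_terms.
apply: EFin_inj; rewrite prE//; apply/negligibleP => //.
rewrite setC_bigcap; apply: negligible_bigcup => k.
rewrite setC_le0 setCK; apply/negligibleP; first exact: measurable_event_le.
by rewrite /= -prE ?Z_gt0//; exact: measurable_event_le.
Qed.

Lemma wsum_positive_le w j k : positive_terms w -> (j <= k)%N ->
  wsum u Z (iota 0 j) w <= wsum u Z (iota 0 k) w.
Proof.
move=> pw /subnKC <-; rewrite iotaD add0n /wsum big_cat/= lerDl.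
by rewrite sumr_ge0// => i _; rewrite mulr_ge0// ltW// pw.
Qed.

Lemma limit_cdf_le_partial K x : limit_cdf x <= partial_cdf K x.
Proof. by apply: pr_le => // w /(_ K); exact. Qed.

Lemma partial_cdf_cvg x q : 0 < q -> \forall K \near \oo,
  partial_cdf K x <= limit_cdf x + q.
Proof.
move=> q0; pose A K := [set w | wsum u Z (iota 0 K) w <= x] `&` positive_terms.
have mp := measurable_positive_terms.
have mA K : measurable (A K) by exact: measurableI.
have capA : \bigcap_K A K =
    (\bigcap_K [set w | wsum u Z (iota 0 K) w <= x]) `&` positive_terms.
  apply/seteqP; split => w /=.
    by move=> Aw; split=> [K _|]; [case: (Aw K I)|case: (Aw 0%N I)].
  by move=> [Ew pw] K _; split => //; exact: Ew.
have : (Q \o A) x @[x --> \oo] --> Q (\bigcap_K A K).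
  apply: nonincreasing_cvg_mu => //.
  - by rewrite -ge0_fin_numE// fin_num_measure.
  - exact: bigcapT_measurable.
  - move=> j k jk; apply/subsetPset => w [kw pw]; split => //.
    exact: le_trans (wsum_positive_le pw jk) kw.
have full B (mB : measurable B) := pr_setI_full mB mp pr_positive_terms.
rewrite capA -(prE Q (measurableI _ _ (mEoo x) mp)) full//.
move=> /fine_cvgP[_ /cvgrPdist_le /(_ q q0)]; apply: filterS => K /=.
rewrite -/(pr Q (A K)) /A full// -/(partial_cdf K x).
by rewrite ler_norml -/(limit_cdf x) => /andP[? ?]; lra.
Qed.

(** The concentration of [Z 0] bounds that of every partial sum, uniformly in
    the number of terms, hence also that of the limit. *)
Lemma limit_cdf_modulus q : 0 < q ->
  exists2 r : R, 0 < r & forall x, limit_cdf (x + r) <= limit_cdf x + q.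
Proof.
move=> q0; have q20 : 0 < q / 2 by rewrite divr_gt0.
have [r r0 rq] := diffuse_modulus (mZ 0%N) Z_diffuse q20.
exists (r / 2) => [|x]; first by rewrite divr_gt0.
have [K [K0 Kx]] : exists K, (0 < K)%N /\ partial_cdf K x <= limit_cdf x + q / 2.
  near \oo => K; exists K; split; near: K; first by exists 1%N.
  exact: partial_cdf_cvg.
apply: le_trans (limit_cdf_le_partial K _) _.
rewrite (splitr q) addrA; apply: le_trans (lerD Kx (lexx _)).
have mc := measurable_event_oc (mwZ K) x (x + r / 2).
apply: le_trans (_ : _ <= partial_cdf K x +
    pr Q [set w | x < wsum u Z (iota 0 K) w <= x + r / 2]) _.
  apply: pr_leD => // w /=.
  by have [|] := leP (wsum u Z (iota 0 K) w) x; [left|right; apply/andP].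
rewrite lerD2l; case: K K0 {Kx mc} => // K _.
apply: (@wsum_concentration _ _ _ Q Z predT u mZ indZ u_ge0 0%N r) => //.
- by move=> y; rewrite /u expr0 invr1; under eq_set do rewrite mul1r; exact: rq.
- by rewrite -[0%N :: _]/(iota 0 K.+1) iota_uniq.
- by apply/allP.
- by lra.
Unshelve. all: end_near. Qed.

(** Uniformity in [c'] near [c] is what lets the argument vary with [m]. *)
Lemma scaled_sum_cdf_cvg c q : 0 < q -> exists2 r : R, 0 < r &
  \forall m \near \oo, forall c', `|c' - c| <= r ->
    `|pr P [set w | scaled_sum a Y m w <= c'] - limit_cdf c| <= q.
Proof.
move=> q0; have q30 : 0 < q / 3 by rewrite divr_gt0.
have [r r0 rq] := limit_cdf_modulus q30.
have r30 : 0 < r / 3 by rewrite divr_gt0.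
exists (r / 3) => //.
have up : \forall m \near \oo,
    pr P [set w | scaled_sum a Y m w <= c + r / 3] <= limit_cdf c + q.
  have [K Kc] : exists K, partial_cdf K (c + r) <= limit_cdf (c + r) + q / 3.
    by near \oo => K; exists K; near: K; exact: partial_cdf_cvg.
  have := scaled_sum_cdf_le K (c + r / 3) r30 q30; apply: filterS => m.
  have : partial_cdf K (c + r / 3 + r / 3) <= partial_cdf K (c + r).
    by apply: pr_le => // w /= /le_trans; apply; lra.
  by have := rq c; lra.
have lo : \forall m \near \oo,
    limit_cdf c - q <= pr P [set w | scaled_sum a Y m w <= c - r / 3].
  have aK := expV_mul_cvg0 (C / (r / 3)) a_gt1.
  have [K Kc] : exists K, a ^- K * (C / (r / 3)) <= q / 3.
    near \oo => K; exists K; near: K; have /cvgr0Pnorm_le/(_ _ q30) := aK.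
    by apply: filterS => K; exact: le_trans (ler_norm _).
  have := scaled_sum_cdf_ge K (c - r / 3) r30 q30; apply: filterS => m.
  have := limit_cdf_le_partial K (c - r / 3 - r / 3 - r / 3).
  have -> : c - r / 3 - r / 3 - r / 3 = c - r by lra.
  by have := rq (c - r); rewrite subrK; lra.
move: up lo; apply: filterS2 => m up lo c'; rewrite !ler_norml => /andP[? ?].
have : pr P [set w | scaled_sum a Y m w <= c'] <=
    pr P [set w | scaled_sum a Y m w <= c + r / 3].
  apply: pr_le; try exact: measurable_event_le.
  by move=> w /= /le_trans; apply; lra.
have : pr P [set w | scaled_sum a Y m w <= c - r / 3] <=
    pr P [set w | scaled_sum a Y m w <= c'].
  apply: pr_le; try exact: measurable_event_le.
  by move=> w /= /le_trans; apply; lra.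
by move=> ? ?; apply/andP; split; lra.
Unshelve. all: end_near. Qed.

Lemma limit_cdf_le0 x : x <= 0 -> limit_cdf x = 0.
Proof.
move=> x0; apply/eqP; rewrite eq_le pr_ge0 andbT -(Z_gt0 0%N).
apply: pr_le => //; first exact: measurable_event_le.
move=> w /(_ 1%N I) /=; rewrite wsum_cons wsum_nil addr0 /u expr0 invr1 mul1r.
by move/le_trans; apply.
Qed.

(** The tail bound of the scaled sums passes to the limit; it makes the limit
    series almost surely finite. *)
Lemma limit_cdf_ge x : 0 < x -> 1 - C / x <= limit_cdf x.
Proof.
move=> x0; apply/ler_addgt0Pr => q q0.
have [r r0 [N _ /(_ N (leqnn N)) /= Sx]] := scaled_sum_cdf_cvg x q0.
have : `|x - x| <= r by rewrite subrr normr0 ltW.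
move=> /Sx; rewrite ler_norml => /andP[? ?].
have : pr P [set w | scaled_sum a Y N w <= x] =
    1 - pr P [set w | x < scaled_sum a Y N w].
  have := pr_setC P (measurable_event_le (mS N) x).
  have -> : ~` [set w | scaled_sum a Y N w <= x] = [set w | x < scaled_sum a Y N w].
    by apply/seteqP; split => w /=; rewrite ltNge => /negP.
  by move=> ->; rewrite opprB addrC subrK.
by have := tailY N x0; lra.
Qed.

End limit_of_scaled_sums.

(** * Weak convergence of integer-valued variables *)

Section step_functions.
Context {d} {T : measurableType d} {R : realType} (P : probability T R).

Lemma Rintegral_step (M : R) (n : nat) (b : nat -> R) (A : nat -> set T) :
  (forall i, measurable (A i)) ->
  P.-integrable setT (EFin \o (fun w => M + \sum_(i < n) b i * \1_(A i) w)) /\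
  (\int[P]_w (M + \sum_(i < n) b i * \1_(A i) w))%R =
  M + \sum_(i < n) b i * pr P (A i).
Proof.
move=> mA; elim: n => [|n [intn IH]].
  under eq_fun do rewrite big_ord0 addr0.
  rewrite big_ord0 addr0; split; first exact: finite_measure_integrable_cst.
  by rewrite Rintegral_cst// -/(pr P setT) pr_setT mulr1.
have int1 : P.-integrable setT (EFin \o (\1_(A n) : T -> R)).
  exact: integrable_indic.
have intb : P.-integrable setT (EFin \o (fun w => b n * \1_(A n) w)).
  by have := integrableZl measurableT (b n) int1.
have E w : M + \sum_(i < n.+1) b i * \1_(A i) w =
    (M + \sum_(i < n) b i * \1_(A i) w) + b n * \1_(A n) w.
  by rewrite big_ord_recr/= addrA.
under eq_fun do rewrite E.
split; first by have := integrableD measurableT intn intb.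
rewrite RintegralD// IH RintegralZl// big_ord_recr/= addrA; congr (_ + b n * _).
by rewrite /Rintegral integral_indic// setIT.
Qed.

Lemma integrable_bounded_comp (X : {RV P >-> R}) (f : R -> R) (M : R) :
  measurable_fun setT f -> (forall x, `|f x| <= M) ->
  P.-integrable setT (EFin \o (f \o X)).
Proof.
move=> mf fM; apply: measurable_bounded_integrable => //.
- by rewrite (le_lt_trans (probability_le1 P measurableT))// ltry.
- exact: measurableT_comp.
- exists M; split; first exact: num_real.
  by move=> y My w _ /=; apply: le_trans (fM _) (ltW My).
Qed.

(** An integer-valued variable is seen through its point masses in [-J, J[; off
    these points [f] is replaced by its bound. *)
Lemma Rintegral_integer_le (X : {RV P >-> R}) (f : R -> R) (M : R) (J : nat) :
  (forall w, exists z : int, X w = z%:~R) -> measurable_fun setT f ->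
  (forall x, `|f x| <= M) ->
  (\int[P]_w f (X w))%R <= M + \sum_(i < 2 * J)
    (f (i%:Z - J%:Z)%:~R - M) * pr P [set w | X w = (i%:Z - J%:Z)%:~R].
Proof.
move=> Xint mf fM.
pose A (i : nat) := [set w | X w = (i%:Z - J%:Z)%:~R].
have mA i : measurable (A i).
  exact: (@measurable_preimage _ _ _ X (measurable_funPT X)
    [set (i%:Z - J%:Z)%:~R]).
have [intF <-] := Rintegral_step M (2 * J)
  (fun i => f (i%:Z - J%:Z)%:~R - M) mA.
apply: le_Rintegral => //; first exact: integrable_bounded_comp mf fM.
move=> w _; have fw : f (X w) <= M by exact: le_trans (ler_norm _) (fM _).
have [z Xz] := Xint w.
have AE i : \1_(A i) w = (z == i%:Z - J%:Z)%:R :> R.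
  rewrite indicE; congr (_%:R); congr nat_of_bool.
  by rewrite -(eqr_int R) -Xz; apply/idP/eqP => [|wi]; rewrite inE.
have [zJ|zJ] := boolP ((- J%:Z <= z) && (z < J%:Z)).
  have zi : (absz (z + J%:Z)%R < 2 * J)%N by lia.
  rewrite (bigD1 (Ordinal zi))//= AE.
  have -> : (absz (z + J%:Z)%R)%:Z - J%:Z = z by lia.
  rewrite eqxx mulr1 big1 => [|i iz]; first by rewrite Xz; lra.
  rewrite AE; case: eqP => [zE|_]; last by rewrite mulr0.
  by exfalso; move/eqP: iz; apply; apply/val_inj => /=; lia.
rewrite big1 ?addr0// => i _; rewrite AE; case: eqP => [zE|_].
  by have := ltn_ord i; lia.
by rewrite mulr0.
Qed.

Lemma Rintegral_integer_approx (X : {RV P >-> R}) (f : R -> R) (M : R) (J : nat) :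
  (forall w, exists z : int, X w = z%:~R) -> measurable_fun setT f ->
  (forall x, `|f x| <= M) ->
  `|(\int[P]_w f (X w))%R - \sum_(i < 2 * J)
    f (i%:Z - J%:Z)%:~R * pr P [set w | X w = (i%:Z - J%:Z)%:~R]| <=
  M * (1 - \sum_(i < 2 * J) pr P [set w | X w = (i%:Z - J%:Z)%:~R]).
Proof.
move=> Xint mf fM; have up := Rintegral_integer_le J Xint mf fM.
have mNf : measurable_fun setT (fun x => -1 * f x) by exact: measurable_funM.
have NfM x : `|-1 * f x| <= M by rewrite mulN1r normrN.
have := Rintegral_integer_le J Xint mNf NfM.
rewrite RintegralZl//; last exact: integrable_bounded_comp mf fM.
move: up; set I := (\int[P]_w f (X w))%R; set p := fun i : nat =>
  pr P [set w | X w = (i%:Z - J%:Z)%:~R].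
have sumE (g : R -> R) : \sum_(i < 2 * J) (g (i%:Z - J%:Z)%:~R - M) * p i =
    \sum_(i < 2 * J) g (i%:Z - J%:Z)%:~R * p i - M * \sum_(i < 2 * J) p i.
  by rewrite mulr_sumr -sumrB; apply: eq_bigr => i _; rewrite mulrBl.
rewrite (sumE f) (sumE (fun x => -1 * f x)).
under [X in _ -> _ <= M + (X - _) -> _]eq_bigr do rewrite -mulrA.
by rewrite -mulr_sumr ler_norml => ? ?; apply/andP; split; lra.
Qed.

Lemma integral_distribution_bounded (X : {RV P >-> R}) (f : R -> R) (M : R) :
  measurable_fun setT f -> (forall x, `|f x| <= M) ->
  (\int[distribution P X]_x (f x)%:E)%E = (\int[P]_w f (X w))%R%:E.
Proof.
move=> mf fM; have intf := integrable_bounded_comp X mf fM.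
rewrite integral_distribution//; last exact/measurable_EFinP.
by rewrite /Rintegral fineK//; exact: integrable_fin_num.
Qed.

Lemma pr_integer_eq (X : {RV P >-> R}) (z : int) :
  (forall w, exists z : int, X w = z%:~R) ->
  pr P [set w | X w = z%:~R] =
  pr P [set w | z%:~R <= X w] - pr P [set w | (z + 1)%:~R <= X w].
Proof.
move=> Xint.
have mE := @measurable_preimage _ _ _ X (measurable_funPT X) [set z%:~R].
have -> : [set w | z%:~R <= X w] =
    [set w | X w = z%:~R] `|` [set w | (z + 1)%:~R <= X w].
  apply/seteqP; split => w /=; have [y ->] := Xint w; rewrite !ler_int.
    by move=> zy; have [->|yz] := eqVneq y z; [left|right; lia].
  by move=> [/eqP|]; rewrite ?eqr_int; lia.
rewrite pr_setU ?addrK//; [exact: mE|exact: measurable_event_ge|].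
rewrite -subset0 => w [/= ->]; rewrite ler_int; lia.
Qed.

Lemma sum_pr_integer_eq (X : {RV P >-> R}) (J : nat) :
  (forall w, exists z : int, X w = z%:~R) ->
  \sum_(i < 2 * J) pr P [set w | X w = (i%:Z - J%:Z)%:~R] =
  pr P [set w | (- J%:Z)%:~R <= X w] - pr P [set w | J%:Z%:~R <= X w].
Proof.
move=> Xint; under eq_bigr do rewrite pr_integer_eq//.
pose g (i : nat) := - pr P [set w | (i%:Z - J%:Z)%:~R <= X w].
rewrite (eq_bigr (fun i : 'I_(2 * J) => g i.+1 - g i)); last first.
  move=> i _; rewrite /g opprK addrC.
  by have -> : i.+1%:Z - J%:Z = i%:Z - J%:Z + 1 by lia.
rewrite -(big_mkord xpredT (fun i => g i.+1 - g i)) telescope_sumr// /g opprK.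
have -> : (2 * J)%N%:Z - J%:Z = J%:Z by lia.
by rewrite sub0r addrC.
Qed.

Lemma integer_tail (X : {RV P >-> R}) (q : R) :
  (forall w, exists z : int, X w = z%:~R) -> 0 < q -> exists J : nat,
  1 - q <= \sum_(i < 2 * J) pr P [set w | X w = (i%:Z - J%:Z)%:~R].
Proof.
move=> Xint q0; have [M M0 tail] := pr_tail P q0 (measurable_funPT X).
exists (Num.truncn M).+1; rewrite sum_pr_integer_eq//.
set J := (Num.truncn M).+1.
have MJ : M < J%:R by exact: truncnS_gt.
have mM := measurable_event_oc (measurable_funPT X) (- M) M.
rewrite pr_setC// in tail.
have : pr P ([set w | - M < X w <= M] `|` [set w | J%:Z%:~R <= X w]) <=
    pr P [set w | (- J%:Z)%:~R <= X w].
  apply: pr_le; [by apply: measurableU => //; exact: measurable_event_ge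
                |exact: measurable_event_ge|].
  move=> w /=; rewrite mulrNz -pmulrn => -[/andP[? ?]|?]; first by lra.
  by have : 0 <= J%:R :> R by []; lra.
rewrite pr_setU//; [by lra|exact: measurable_event_ge|].
by rewrite -subset0 => w [/= /andP[_ XM]]; rewrite -pmulrn; lra.
Qed.

End step_functions.

(** For integer-valued variables, convergence of all tail probabilities
    [P (X_n >= j)] is convergence of all point masses; as no mass escapes from a
    large window in the limit, none does along the sequence. *)
Lemma weak_cvg_integer {d d'} {T : measurableType d} {T' : measurableType d'}
    {R : realType} (P : probability T R) (Q : probability T' R)
    (X_ : nat -> {RV P >-> R}) (X : {RV Q >-> R}) :
  (\forall n \near \oo, forall w, exists z : int, X_ n w = z%:~R) ->
  (forall w, exists z : int, X w = z%:~R) ->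
  (forall j : int, pr P [set w | j%:~R <= X_ n w] @[n --> \oo] -->
    pr Q [set w | j%:~R <= X w]) ->
  weak_cvg (fun n => distribution P (X_ n)) (distribution Q X).
Proof.
move=> X_int Xint X_X f cf [M0 [_ /(_ (`|M0| + 1))]].
have M0M : M0 < `|M0| + 1 by rewrite ltr_pwDr// ler_norm.
move=> /(_ M0M); set M := `|M0| + 1 => fM'.
have fM x : `|f x| <= M by exact: fM'.
have M_gt0 : 0 < M by rewrite /M ltr_pwDr.
have mf : measurable_fun setT f by exact: continuous_measurable_fun.
under eq_fun do rewrite (integral_distribution_bounded _ mf fM).
rewrite (integral_distribution_bounded _ mf fM).
apply/fine_cvgP; split; first exact: nearW.
apply/cvgrPdist_le => e e0 /=; have e40 : 0 < e / 4 by rewrite divr_gt0.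
have eM0 : 0 < e / 4 / M by rewrite divr_gt0.
have [J Jtail] := integer_tail Xint eM0.
pose p n (i : nat) := pr P [set w | X_ n w = (i%:Z - J%:Z)%:~R].
pose p0 (i : nat) := pr Q [set w | X w = (i%:Z - J%:Z)%:~R].
have p_cvg i : p n i @[n --> \oo] --> p0 i.
  rewrite /p0 pr_integer_eq//.
  have pB := cvgB (X_X (i%:Z - J%:Z)) (X_X (i%:Z - J%:Z + 1)).
  apply: (cvg_trans _ (pB _)); apply: near_eq_cvg; apply: filterS X_int => n Xnint.
  by rewrite /p pr_integer_eq.
have S_cvg : \sum_(i < 2 * J) f (i%:Z - J%:Z)%:~R * p n i @[n --> \oo] -->
    \sum_(i < 2 * J) f (i%:Z - J%:Z)%:~R * p0 i.
  apply: cvg_big => [|i _]; [exact: add_continuous|].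
  apply: cvgMr; exact: p_cvg.
have q_cvg : \sum_(i < 2 * J) p n i @[n --> \oo] --> \sum_(i < 2 * J) p0 i.
  by apply: cvg_big => [|i _]; [exact: add_continuous|]; exact: p_cvg.
move/cvgrPdist_le/(_ _ e40) in S_cvg; move/cvgrPdist_le/(_ _ eM0) in q_cvg.
have I0 := Rintegral_integer_approx J Xint mf fM.
apply: filterS3 X_int S_cvg q_cvg => n Xnint Sn qn.
have := Rintegral_integer_approx J Xnint mf fM.
move: Sn qn I0 Jtail; rewrite -/(p0 _) -/(p n _).
set S := \sum_(i < _) _ * p0 _; set Sn := \sum_(i < _) _ * p n _.
set q := \sum_(i < _) p0 _; set qn := \sum_(i < _) p n _.
set I0 := (\int[_]_w _)%R; set In := (\int[_]_w _)%R => Sn_S qn_q I0_S q1 In_S.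
have MeM : M * (e / 4 / M) = e / 4 by field; rewrite gt_eqF.
have Mq : M * (1 - q) <= e / 4.
  by rewrite -MeM; apply: ler_wpM2l; [exact: ltW|rewrite lerBlDr addrC -lerBlDr].
have Mqn : M * (1 - qn) <= e / 4 + e / 4.
  rewrite -[X in X + X]MeM -mulrDr; apply: ler_wpM2l; first exact: ltW.
  move: qn_q q1; rewrite ler_norml; move: (e / 4 / M) => x /andP[? ?] ?; lra.
move: Sn_S I0_S In_S; rewrite !ler_norml => /andP[? ?] /andP[? ?] /andP[? ?].
by apply/andP; split; lra.
Qed.

(** * The limit law and the renewal counts *)

Section limit_count_law.
Context {d} {T : measurableType d} {R : realType} (Q : probability T R).
Context (a C : R) (Z : nat -> {mfun T >-> R}).
Hypothesis a_gt1 : 1 < a.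
Hypothesis Z_gt0 : forall k, pr Q [set w | Z k w <= 0] = 0.
Hypothesis tail : forall x, 0 < x -> 1 - C / x <= limit_cdf Q a Z x.

Let a_gt0 : 0 < a. Proof. exact: lt_trans a_gt1. Qed.
Let ln_a_gt0 : 0 < ln a. Proof. by rewrite ln_gt0. Qed.
Let mZ k : measurable_fun setT (Z k). Proof. by []. Qed.

Let E x := \bigcap_K [set w | wsum (fun k => a ^- k) Z (iota 0 K) w <= x].

Let mE x : measurable (E x).
Proof.
by apply: bigcapT_measurable => K; apply/measurable_event_le/measurable_wsum.
Qed.

Let partialE w K : (\sum_(0 <= k < K) (a ^- k * Z k w)%:E)%E =
  (wsum (fun k => a ^- k) Z (iota 0 K) w)%:E.
Proof. by rewrite sumEFin /index_iota subn0. Qed.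

Let term_ge0 w : positive_terms Z w -> forall n : nat, (0 <= n)%N -> true ->
  (0 <= (a ^- n * Z n w)%:E)%E.
Proof.
move=> pw n _ _; rewrite lee_fin mulr_ge0 ?invr_ge0 ?exprn_ge0 ?(ltW a_gt0)//.
exact/ltW/pw.
Qed.

Let series_le w x : positive_terms Z w ->
  E x w <-> (discounted_series a Z w <= x%:E)%E.
Proof.
move=> pw; have t0 := term_ge0 pw; split.
  move=> Ew; apply: lime_le; first exact: is_cvg_nneseries.
  by apply: nearW => K; rewrite partialE lee_fin; exact: Ew.
move=> sx K _ /=; rewrite -lee_fin -partialE; apply: le_trans sx.
exact: nneseries_lim_ge.
Qed.

Let series_gt0 w : positive_terms Z w -> (0 < discounted_series a Z w)%E.
Proof.
move=> pw; apply: lt_le_trans (nneseries_lim_ge 1 (term_ge0 pw)).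
by rewrite big_nat1 expr0 invr1 mul1r lte_fin; exact: pw.
Qed.

(** On this almost sure event the series is positive and finite, so that its
    logarithm is not a default value. *)
Let G := positive_terms Z `&` \bigcup_n E n.+1%:R.

Let mG : measurable G.
Proof.
apply: measurableI; first exact: measurable_positive_terms.
exact: bigcupT_measurable.
Qed.

Let prG : pr Q (~` G) = 0.
Proof.
apply/eqP; rewrite eq_le pr_ge0 andbT; apply/ler_addgt0Pr => q q0; rewrite add0r.
pose n := Num.truncn (C / q).
have Cn : C / n.+1%:R <= q.
  have := truncnS_gt (C / q); rewrite -/n ltr_pdivrMr// => /ltW.
  by rewrite ler_pdivrMr ?ltr0n// mulrC.
have mp := measurable_positive_terms mZ.
apply: le_trans (_ : _ <= pr Q (~` positive_terms Z) + pr Q (~` E n.+1%:R)) _.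
  apply: pr_leD; try exact: measurableC.
  rewrite /G setCI; by apply: setUS; apply: subsetC => w Ew; exists n.
rewrite pr_positive_terms// add0r pr_setC//.
have : 0 < n.+1%:R :> R by rewrite ltr0n.
move=> /tail En; have {En} : 1 - C / n.+1%:R <= pr Q (E n.+1%:R) := En.
by rewrite lerBlDr -lerBlDl => /le_trans; exact.
Qed.

Lemma pr_limit_count_ge (eta : R) (j : int) :
  pr Q [set w | j%:~R <= limit_count a eta Z w] =
  limit_cdf Q a Z (a `^ (eta - j%:~R)).
Proof.
apply: (pr_eq_on _ (mE _) mG prG) => [|w [pw [n _ Ew]]].
  exact: measurable_event_ge.
have sn := (series_le _ pw).1 Ew; have s0 := series_gt0 pw.
have sfin : discounted_series a Z w \is a fin_num.
  by rewrite ge0_fin_numE ?(ltW s0)// (le_lt_trans sn)// ltry.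
rewrite series_le//= -(fineK sfin) lee_fin /limit_count ler_int floor_ge_int.
move: s0; rewrite -(fineK sfin) lte_fin /=; set s := fine _ => s0.
have -> : (s <= a `^ (eta - j%:~R)) = (ln s / ln a <= eta - j%:~R).
  by rewrite ler_pdivrMr// -ln_powR ler_ln ?posrE ?powR_gt0.
by rewrite /log_base; split; lra.
Qed.

End limit_count_law.

Section renewal_count_events.
Context {d} {T : measurableType d} {R : realType} (Y : nat -> {mfun T >-> R}).
Hypothesis Y_ge0 : forall k, (1 <= k)%N -> forall w, 0 <= Y k w.

Lemma partial_sum_le w m n : (m <= n)%N -> partial_sum Y m w <= partial_sum Y n w.
Proof.
move=> mn; rewrite /partial_sum (@big_cat_nat _ _ _ m.+1 _ n.+1)//=.
rewrite lerDl big_nat_cond sumr_ge0// => k /andP[/andP[mk _] _].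
by rewrite Y_ge0//; lia.
Qed.

Lemma renewal_countE (t : R) (w : T) (n : nat) : 0 <= t ->
  t < partial_sum Y n w -> exists2 N : nat, renewal_count Y t w = N%:R &
    forall m, (partial_sum Y m w <= t) = (m <= N)%N.
Proof.
move=> t0 tn.
have ex_gt : exists n, t < partial_sum Y n w by exists n.
case: (ex_minnP ex_gt) => n0 tn0 n0_min {n tn ex_gt}.
have n0_gt0 : (0 < n0)%N.
  rewrite lt0n; apply/eqP => n00; move: tn0; rewrite n00 /partial_sum big_geq//.
  by rewrite ltNge t0.
have Sle k : (partial_sum Y k w <= t) = (k <= n0.-1)%N.
  rewrite -ltnS prednK//; apply/idP/idP => [kt|].
    rewrite ltnNge; apply: contraL tn0 => n0k; rewrite -leNgt.
    exact: le_trans (partial_sum_le w n0k) kt.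
  by rewrite ltnNge leNgt; apply: contra; exact: n0_min.
exists n0.-1 => //; rewrite /renewal_count.
suff -> : renewal_sup Y t w = n0.-1%:R%:E by [].
apply/eqP; rewrite eq_le; apply/andP; split.
  by apply: ge_ereal_sup => _ [k /= kt <-]; rewrite lee_fin ler_nat -Sle.
by apply: ereal_sup_ubound; exists n0.-1 => //=; rewrite Sle.
Qed.

(** The supremum is then infinite, and its real value is a default. *)
Lemma renewal_count_default (t : R) (w : T) :
  (forall n, partial_sum Y n w <= t) -> renewal_count Y t w = 0.
Proof.
move=> Sle; rewrite /renewal_count; suff -> : renewal_sup Y t w = +oo%E by [].
apply/eqyP => A A0; apply: (@le_trans _ _ (Num.truncn A).+1%:R%:E).
  by rewrite lee_fin ltW// truncnS_gt.
by apply: ereal_sup_ubound; exists (Num.truncn A).+1 => //; exact: Sle.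
Qed.

Lemma renewal_count_int (t : R) (w : T) : 0 <= t ->
  exists z : int, renewal_count Y t w = z%:~R.
Proof.
move=> t0; have [[n tn]|none] := pselect (exists n, t < partial_sum Y n w).
  by have [N -> _] := renewal_countE t0 tn; exists N%:Z.
exists 0; apply: renewal_count_default => n.
by rewrite leNgt; apply/negP => tn; apply: none; exists n.
Qed.

End renewal_count_events.

Section renewal_count_law.
Context {d} {T : measurableType d} {R : realType} (P : probability T R).
Context (a : R) (Y : nat -> {mfun T >-> R}).
Hypothesis a_gt1 : 1 < a.
Hypothesis Y_ge0 : forall k, (1 <= k)%N -> forall w, 0 <= Y k w.
Hypothesis escape : forall q, 0 < q -> exists2 r : R, 0 < r &
  \forall m \near \oo, pr P [set w | scaled_sum a Y m w <= r] <= q.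

Let a_gt0 : 0 < a. Proof. exact: lt_trans a_gt1. Qed.

Let scaled_sum_le m c w :
  (scaled_sum a Y m w <= a ^- m * c) = (partial_sum Y m w <= c).
Proof. by rewrite /scaled_sum ler_pM2l// invr_gt0 exprn_gt0. Qed.

Let mS m c : measurable [set w | partial_sum Y m w <= c].
Proof. by apply: measurable_event_le; exact: measurable_sum. Qed.

Let unbounded c : set T := ~` \bigcap_m [set w | partial_sum Y m w <= c].

Let m_unbounded c : measurable (unbounded c).
Proof. by apply: measurableC; exact: bigcapT_measurable. Qed.

Let pr_unbounded c : pr P (~` unbounded c) = 0.
Proof.
apply/eqP; rewrite eq_le pr_ge0 andbT; apply/ler_addgt0Pr => q q0; rewrite add0r.
have [r r0 small] := escape q0.
have [m [acr prm]] : exists m, a ^- m * c <= r /\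
    pr P [set w | scaled_sum a Y m w <= r] <= q.
  have /cvgr0Pnorm_le/(_ _ r0) acn := expV_mul_cvg0 c a_gt1.
  near \oo => m; exists m; split; last by near: m.
  by apply: le_trans (ler_norm _) _; near: m.
apply: le_trans prm; apply: pr_le; first exact: measurableC.
  by apply: measurable_event_le; exact: measurable_scaled_sum.
rewrite /unbounded setCK => w /(_ m I) /= Sm.
by apply: le_trans acr; rewrite scaled_sum_le.
Unshelve. all: end_near. Qed.

(** Up to the null event that the partial sums stay bounded, at least [m]
    renewals occur by time [c] exactly when the [m]-th one does. *)
Lemma pr_renewal_count_ge (c : R) (m : nat) : 0 <= c ->
  pr P [set w | m%:R <= renewal_count Y c w] =
  pr P [set w | scaled_sum a Y m w <= a ^- m * c].
Proof.
move=> c0; have -> : [set w | scaled_sum a Y m w <= a ^- m * c] =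
    [set w | partial_sum Y m w <= c].
  by apply/seteqP; split => w; rewrite /= scaled_sum_le.
apply: (pr_eq_on _ (mS m c) (m_unbounded c) (pr_unbounded c)).
  exact: measurable_event_ge.
move=> w /existsNP[n /not_implyP[_ /negP]]; rewrite -ltNge => cn.
have [N EN Sle] := renewal_countE Y_ge0 c0 cn.
by rewrite /= EN ler_nat Sle.
Qed.

End renewal_count_law.

Lemma log_base_powR {R : realType} (a x : R) : 1 < a -> 0 < x ->
  a `^ log_base a x = x.
Proof.
move=> a1 x0; have a0 : 0 < a by exact: lt_trans a1.
rewrite /powR gt_eqF// /log_base divfK ?lnK ?posrE//.
by rewrite gt_eqF// ln_gt0.
Qed.

Lemma log_base_cvgy {R : realType} (a : R) (t : nat -> R) : 1 < a ->
  t n @[n --> \oo] --> +oo -> forall b, \forall n \near \oo, b <= log_base a (t n).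
Proof.
move=> a1 ty b; have a0 : 0 < a by exact: lt_trans a1.
have lna : 0 < ln a by rewrite ln_gt0.
have /cvgryPge/(_ (a `^ b)) := ty; apply: filterS => n abn.
have ab0 : 0 < a `^ b by rewrite powR_gt0.
rewrite /log_base ler_pdivlMr// -ln_powR ler_ln ?posrE//.
exact: lt_le_trans abn.
Qed.

Theorem theorem2 (R : realType) (alpha : R) (alpha_gt1 : 1 < alpha)
  (d : measure_display) (T : measurableType d) (P : probability T R)
  (Y : nat -> {RV P >-> R})
  (Y_indep : mutually_independent P [set k : nat | (1 <= k)%N] Y)
  (Y_ge0 : forall k : nat, (1 <= k)%N -> forall w : T, 0 <= Y k w)
  (Y_int : forall k : nat, (1 <= k)%N -> P.-integrable setT (EFin \o Y k))
  (d' : measure_display) (T' : measurableType d') (P' : probability T' R)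
  (Yoo : {RV P' >-> R})
  (Yoo_int : P'.-integrable setT (EFin \o Yoo))
  (Y_cvg : weak_cvg (fun k : nat => distribution P (alpha ^- k \o* Y k))
                    (distribution P' Yoo))
  (EY_cvg : ((alpha ^- k)%:E * 'E_P[Y k])%E @[k --> \oo] --> 'E_P'[Yoo]%E)
  (Yoo_diffuse : forall y : R, 0 <= y -> distribution P' Yoo [set y] = 0%E)
  (d'' : measure_display) (T'' : measurableType d'') (P'' : probability T'' R)
  (Z : nat -> {RV P'' >-> R})
  (Z_indep : mutually_independent P'' setT Z)
  (Z_law : forall (k : nat) (A : set R), measurable A ->
     distribution P'' (Z k) A = distribution P' Yoo A)
  (eta : R) (eta_ge0 : 0 <= eta) (eta_le1 : eta <= 1)
  (t : nat -> R) (t_cvg : t n @[n --> \oo] --> +oo)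
  (t_frac : frac_part (log_base alpha (t n)) @[n --> \oo] --> eta) :
  weak_cvg
    (fun n : nat => distribution P
       (renewal_count Y (t n) \- cst ((Num.floor (log_base alpha (t n)))%:~R)))
    (limit_law P'' alpha eta Z).
Proof.
have a_gt0 : 0 < alpha by exact: lt_trans alpha_gt1.
have mY k : measurable_fun setT (Y k) by [].
have mZ k : measurable_fun setT (Z k) by [].
(* the limit law is carried by the positive half-line and has no atoms *)
have mu_lt0 c : c < 0 -> pr (distribution P' Yoo) `]-oo, c] = 0.
  apply: (weak_cvg_lt0 Y_cvg) => {}c c0; exists 1%N => // k /= k1.
  rewrite -[RHS](pr_set0 P); congr (fine (P _)); rewrite -subset0 => w /=.
  rewrite in_itv/= leNgt; apply/negP; rewrite negbK; apply: lt_le_trans c0 _.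
  by rewrite mulr_ge0 ?Y_ge0// invr_ge0 exprn_ge0// ltW.
have mu_diffuse y : pr (distribution P' Yoo) [set y] = 0.
  have [y0|y0] := leP 0 y; first exact: (congr1 fine (Yoo_diffuse y y0)).
  apply/eqP; rewrite eq_le pr_ge0 andbT -(mu_lt0 _ y0); apply: pr_le => //.
  by move=> z /= ->; rewrite in_itv/=.
have mu_le0 : pr (distribution P' Yoo) `]-oo, 0] = 0.
  apply/eqP; rewrite eq_le pr_ge0 andbT; apply/ler_addgt0Pr => q q0.
  have [r r0 /(_ (- r))] := diffuse_cdf_modulus mu_diffuse q0.
  by rewrite addNr (mu_lt0 (- r)) ?oppr_lt0// add0r.
have prZ k B : measurable B -> pr P'' (Z k @^-1` B) = pr (distribution P' Yoo) B.
  by move=> mB; exact: (congr1 fine (Z_law k B mB)).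
have Z_gt0 k : pr P'' [set w | Z k w <= 0] = 0.
  apply: etrans mu_le0; rewrite -(prZ k)//; congr pr.
have Z_diffuse y : pr P'' [set w | Z 0%N w = y] = 0.
  by apply: etrans (mu_diffuse y); rewrite -(prZ 0%N).
have YZ k x y :
    pr P [set w | x < alpha ^- m * Y m w <= y] - pr P'' [set w | x < Z k w <= y]
      @[m --> \oo] --> (0 : R).
  have mu_xy := weak_cvg_itv Y_cvg mu_diffuse x y.
  apply/cvgr0Pnorm_le => q q0; have /cvgr0Pnorm_le/(_ q q0) := mu_xy.
  apply: filterS => m; rewrite -(prZ k)//.
  suff -> : pr (distribution P (alpha ^- m \o* Y m)) `]x, y] =
      pr P [set w | x < alpha ^- m * Y m w <= y].
    by rewrite (_ : Z k @^-1` _ = [set w | x < Z k w <= y])//;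
      apply/seteqP; split => w; rewrite /= in_itv.
  congr (fine (P _)); apply/seteqP; split => w;
    by rewrite /= in_itv/= [_ * alpha ^- m]mulrC.
have EYoo_fin : 'E_P'[Yoo]%E \is a fin_num.
  by rewrite unlock; exact: integrable_fin_num.
have [B B0 EY] : exists2 B : R, 0 <= B & forall k, (1 <= k)%N ->
    (\int[P]_w (Y k w)%:E <= (B * alpha ^+ k)%:E)%E.
  apply: (@scaled_means_bounded _ _ _ P alpha (fine 'E_P'[Yoo])) => //.
  by rewrite fineK.
have tailY := scaled_sum_tail alpha_gt1 mY Y_ge0 B0 EY.
have indY : product_rule P [pred k | (1 <= k)%N] (fun k => Y k).
  exact: (independent_product_rule Y_indep).
have indZ : product_rule P'' predT (fun k => Z k).
  apply: independent_product_rule => J A _ mA; exact: Z_indep.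
have S_cvg := scaled_sum_cdf_cvg alpha_gt1 mY Y_ge0 indY mZ Z_gt0 Z_diffuse
  indZ YZ tailY.
have G_tail := limit_cdf_ge alpha_gt1 mY Y_ge0 indY mZ Z_gt0 Z_diffuse
  indZ YZ tailY.
have escape q : 0 < q -> exists2 r : R, 0 < r &
    \forall m \near \oo,
      pr P [set w | scaled_sum alpha (fun k => Y k) m w <= r] <= q.
  move=> q0; have [r r0 Sr] := S_cvg 0 q q0; exists r => //.
  apply: filterS Sr => m /(_ r); rewrite subr0 gtr0_norm// => /(_ (lexx _)).
  by rewrite limit_cdf_le0// subr0; apply: le_trans; exact: ler_norm.
have t_gt0 : \forall n \near \oo, 0 < t n by have /cvgryPgt/(_ 0) := t_cvg.
apply: weak_cvg_integer.
- apply: filterS t_gt0 => n tn w /=.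
  have [z ->] := renewal_count_int Y_ge0 w (ltW tn).
  by exists (z - Num.floor (log_base alpha (t n))); rewrite rmorphB.
- move=> w; rewrite /limit_count.
  by exists (Num.floor
    (- log_base alpha (fine (discounted_series alpha Z w)) + eta)).
move=> j; rewrite (pr_limit_count_ge alpha_gt1 Z_gt0 G_tail).
set c := alpha `^ _.
apply/cvgrPdist_le => e e0; have [r r0 [N _ SN]] := S_cvg c e e0.
have c_cvg : alpha `^ (frac_part (log_base alpha (t n)) - j%:~R)
    @[n --> \oo] --> c.
  have h : (frac_part (log_base alpha (t n)) - j%:~R) * ln alpha @[n --> \oo] -->
      (eta - j%:~R) * ln alpha.
    by apply: cvgMl; apply: cvgB => //; exact: cvg_cst.
  rewrite /c /powR gt_eqF//.
  exact: (cvg_comp _ _ h (@continuous_expR R _)).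
have L_large := log_base_cvgy alpha_gt1 t_cvg (N%:R - j%:~R + 1).
move/cvgrPdist_le/(_ r r0) in c_cvg.
apply: filterS3 t_gt0 c_cvg L_large => n tn cn Ln.
set L := log_base alpha (t n) in cn Ln *.
have m_int : N%:Z <= Num.floor L + j.
  rewrite -lerBlDr floor_ge_int rmorphB/=; lra.
(* the event asks for at least m renewals *)
have [m mE] : exists m : nat, Num.floor L + j = m%:Z.
  by move: m_int; case: (Num.floor L + j) => // m _; exists m.
have -> : [set w | j%:~R <= (renewal_count Y (t n) \- cst (Num.floor L)%:~R) w] =
    [set w | m%:R <= renewal_count Y (t n) w].
  apply/seteqP; split => w; rewrite /= pmulrn -mE rmorphD/=; lra.
rewrite (pr_renewal_count_ge alpha_gt1 Y_ge0 escape)//; last exact: ltW.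
rewrite distrC; apply: SN => /=; first by rewrite -lez_nat -mE.
have -> : alpha ^- m * t n = alpha `^ (frac_part L - j%:~R).
  rewrite -[t n in LHS](log_base_powR alpha_gt1 tn) -/L -powR_mulrn ?ltW//.
  rewrite -powRN mulrC -powRD; last by apply/implyP => _; rewrite gt_eqF.
  congr (_ `^ _); rewrite /frac_part pmulrn -mE rmorphD/=; lra.
by rewrite distrC.
Qed.
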